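(* For each $n$ (at least along some subsequence of $n\to\infty$) let $F_n$ be a given graph with vertex set $\{1,\dots,n\}$, and suppose that $\sup_n s_3(F_n)<\infty$. Let $Z_n$ be the size of the component of $F_n$ containing a uniformly random vertex of $F_n$, and write $s_k:=s_k(F_n)$. Fix $t>0$. Then, as $n\to\infty$: (i) If $t\le 1/s_2$, then $C_1(\tilde G(n,t;F_n))=o_p(n)$. (ii) If $t>1/s_2$, then there is a unique $\rho_n>0$ such that $\rho_n=1-\mathbb{E}\, e^{-\rho_n t Z_n}$, and $C_1(\tilde G(n,t;F_n))=\rho_n n+o_p(n)$. (iii) If $t>1/s_2$, let $\delta_n:=t-1/s_2>0$. Then $$\frac{C_1(\tilde G(n,t;F_n))}{n}\ge 2\delta_n\frac{s_2^3}{s_3}\bigl(1-2\delta_n s_2\bigr)+o_p(1).$$ If further $\delta_n s_2^2 s_4/s_3^2\le \tfrac38$, then also $$\frac{C_1(\tilde G(n,t;F_n))}{n}\le 2\delta_n\frac{s_2^3}{s_3}\Bigl(1+\tfrac83\delta_n\frac{s_2^2 s_4}{s_3^2}\Bigr)+o_p(1).$$ (iv) In (iii), if in addition $\liminf_{n\to\infty}\delta_n>0$, then with high probability $$\frac{C_1(\tilde G(n,t;F_n))}{n}\ge 2\delta_n\frac{s_2^3}{s_3}\bigl(1-2\delta_n s_2\bigr),$$ and, if $\delta_n s_2^2 s_4/s_3^2\le\tfrac38$, with high probability $$\frac{C_1(\tilde G(n,t;F_n))}{n}\le 2\delta_n\frac{s_2^3}{s_3}\Bigl(1+\tfrac83\delta_n\frac{s_2^2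 s_4}{s_3^2}\Bigr).$$ The same results (i)–(iv) hold with $\tilde G(n,t;F_n)$ replaced by $G(n,\lfloor nt/2\rfloor;F_n)$ and by $G^*(n,\lfloor nt/2\rfloor;F_n)$.
   Context: For a graph $G$ with components of sizes $C_1\ge C_2\ge\cdots\ge C_{\kappa}$ (and $C_i:=0$ for $i>\kappa$), define $S_k(G)=\sum_i C_i^k$ and $s_k(G)=S_k(G)/|G|$, where $|G|$ is the number of vertices. Random processes starting from a graph $F$ on vertex set $\{1,\dots,n\}$: $G(n,m;F)$ is obtained from $F$ by adding $m$ of the edges of $K_n$ not in $F$, drawn uniformly at random without replacement (one by one in random order); $G^*(n,m;F)$ is obtained from $F$ by drawing $m$ edges of $K_n$ uniformly at random with replacement and adding each one (doing nothing if it is already present); $\tilde G(n,t;F)$ is the continuous-time version: each of the $\binom n2$ pairs of vertices receives edges according to independent Poisson processes of rate $1/n$, and $\tilde G(n,t;F)$ is $F$ together with all edges that arrived during $[0,t]$. $X_n=o_p(n)$ means $X_n/n\to 0$ in probability; ''with high probability'' means with probability tending to $1$ as $n\to\infty$. *)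

(* Defs.v *)
From HB Require Import structures.
From mathcomp Require Import all_boot all_order all_algebra.
From mathcomp Require Import all_classical all_reals all_analysis.
Set Implicit Arguments. Unset Strict Implicit. Unset Printing Implicit Defensive.
Import Order.TTheory GRing.Theory Num.Theory.
Import numFieldNormedType.Exports.
Local Open Scope ring_scope.

(* Graphs on vertex set 'I_n = {0,..,n-1} (relabelling of {1,..,n}):
   a graph is its edge set, a set of 2-element subsets of 'I_n. *)
Definition graph (n : nat) := {set {set 'I_n}}.

Definition pairs (n : nat) : graph n := [set e : {set 'I_n} | #|e| == 2%N].

Definition simple_graph (n : nat) (E : graph n) : bool := E \subset pairs n.

Definition adj (n : nat) (E : graph n) : rel 'I_n :=
  fun x y => (x != y) && ([set x; y] \in E).

Definition comp (n : nat) (E : graph n) (x : 'I_n) : {set 'I_n} :=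
  [set y | connect (adj E) x y].

Definition comps (n : nat) (E : graph n) : {set {set 'I_n}} :=
  [set comp E x | x in 'I_n].

Definition C1 (n : nat) (E : graph n) : nat := \max_(C in comps E) #|C|.

Definition Sk {R : realType} (n k : nat) (E : graph n) : R :=
  \sum_(C in comps E) (#|C| ^ k)%:R.
Definition sk {R : realType} (n k : nat) (E : graph n) : R :=
  Sk k E / n%:R.

Definition expZ {R : realType} (n : nat) (E : graph n) (a : R) : R :=
  n%:R^-1 * \sum_(x : 'I_n) expR (- (a * #|comp E x|%:R)).

(* Probability that tilde-G(n,t;F) satisfies A.  Each pair of vertices has a
   rate-1/n Poisson process; the pair is an edge at time t iff at least one
   arrival in [0,t], which happens with probability 1 - exp(-t/n),
   independently over pairs.  H is the set of pairs that received arrivals. *)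
Definition Pr_tilde {R : realType} (n : nat) (t : R) (F : graph n)
  (A : pred (graph n)) : R :=
  let p := 1 - expR (- (t / n%:R)) in
  \sum_(H : graph n | H \subset pairs n)
     (\prod_(e in pairs n) (if e \in H then p else 1 - p)) * (A (F :|: H) : nat)%:R.

Definition Pr_unif {R : realType} (n m : nat) (F : graph n)
  (A : pred (graph n)) : R :=
  (#|[set H : graph n | (H \subset pairs n :\: F) && (#|H| == m)]|%:R)^-1 *
  \sum_(H : graph n | (H \subset pairs n :\: F) && (#|H| == m))
     (A (F :|: H) : nat)%:R.

Definition Pr_star {R : realType} (n m : nat) (F : graph n)
  (A : pred (graph n)) : R :=
  (#|pairs n|%:R ^+ m)^-1 *
  \sum_(f : {ffun 'I_m -> {set 'I_n}} | [forall i, f i \in pairs n])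
     (A (F :|: [set f i | i : 'I_m]) : nat)%:R.

Local Open Scope classical_set_scope.
Local Open Scope ring_scope.

Definition conclusions {R : realType} (ns : nat -> nat)
  (F : forall k, graph (ns k)) (t : R)
  (Pr : forall k, pred (graph (ns k)) -> R) : Prop :=
  let s := fun (j k : nat) => (sk j (F k) : R) in
  let frac := fun k (E : graph (ns k)) => (C1 E)%:R / (ns k)%:R : R in
  let delta := fun k => t - (s 2%N k)^-1 in
  let lower := fun k => 2 * delta k * (s 2%N k ^+ 3 / s 3%N k)
                          * (1 - 2 * delta k * s 2%N k) in
  let ratio := fun k => s 2%N k ^+ 2 * s 4%N k / s 3%N k ^+ 2 in
  let upper := fun k => 2 * delta k * (s 2%N k ^+ 3 / s 3%N k)
                          * (1 + 8 / 3 * delta k * ratio k) in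
  let whp := fun (P : forall k, pred (graph (ns k))) =>
               (fun k => Pr k (P k)) @ \oo --> (1 : R) in
  ((forall k, t <= (s 2%N k)^-1) ->
     forall eps : R, 0 < eps -> whp (fun k E => frac k E <= eps))
  /\
  ((forall k, (s 2%N k)^-1 < t ->
      exists! rho : R, 0 < rho /\ rho = 1 - expZ (F k) (rho * t))
   /\
   ((forall k, (s 2%N k)^-1 < t) ->
      forall rho : nat -> R,
        (forall k, 0 < rho k /\ rho k = 1 - expZ (F k) (rho k * t)) ->
        forall eps : R, 0 < eps -> whp (fun k E => `|frac k E - rho k| <= eps)))
  /\
  ((forall k, (s 2%N k)^-1 < t) ->
     (forall eps : R, 0 < eps -> whp (fun k E => lower k - eps <= frac k E))
     /\ ((forall k, delta k * ratio k <= 3 / 8) ->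
         forall eps : R, 0 < eps -> whp (fun k E => frac k E <= upper k + eps)))
  /\
  ((forall k, (s 2%N k)^-1 < t) ->
     (exists c : R, 0 < c /\ \forall k \near \oo, c <= delta k) ->
     whp (fun k E => lower k <= frac k E)
     /\ ((forall k, delta k * ratio k <= 3 / 8) ->
         whp (fun k E => frac k E <= upper k))).
Arguments conclusions {R} ns F t Pr.

(* Main.v *)
Require Import Defs.
From mathcomp Require Import all_boot all_order all_algebra.
From mathcomp Require Import all_classical all_reals all_analysis.
From mathcomp Require Import ring lra.
Import Order.TTheory GRing.Theory Num.Theory.
Import numFieldNormedType.Exports.
Import boot.fintype boot.finset Defs.
Set Implicit Arguments.
Unset Strict Implicit.
Unset Printing Implicit Defensive.
Local Open Scope ring_scope.

(* Write X_h(G) = 1 - expZ G h for the proportion of vertices of G weighted by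
   1 - exp (- h |C(v)|); for small h it measures the vertices in large
   components. In all three models the edges arrive one at a time (the Poisson
   model is a binomial mixture of such chains), and along h_i = h_0 - 2 i x / n
   with x = X_{h_0}(F) the value X_{h_i}(G_i) is nearly a martingale started
   at x, whose second moment is controlled by a discrete Gronwall inequality.
   Hence X_h(G) concentrates at the solution of x = 1 - expZ F (h + t x), which
   tends to rho_n as h -> 0, uniformly in F because (1 - exp (- a c)) / a is
   uniformly steep in a.
   Since C_1 / n (1 - exp (- h C_1)) <= X_h, this bounds C_1 from above. For
   the lower bound, the sum over components of 1 - exp (- h |C|) is at most h n
   and loses on average at least X_h (X_h - C_1 / n) at each step; for h small
   compared with the length of a time window this forces C_1 / n to be close to
   X_h. Parts (iii) and (iv) follow from Taylor bounds on the equation for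
   rho_n. *)

(** * Exponential inequalities and the quotient [(1 - exp (- a c)) / a] *)

Section Exponential.
Context {R : realType}.
Local Open Scope classical_set_scope.
Local Open Scope ring_scope.
Implicit Types a b c y z : R.

(** The estimates on [expZ G h] degenerate as [h] tends to 0 (its derivatives are only bounded by
    [1 / h] and [2 / h ^ 2]), while the giant component is seen only at small [h]. So [h] is fixed
    while [n] grows, and the limit in [h] is left to a deterministic stability statement, uniform
    over graphs. The second moment closes for the following reason. Let [W] be minus the derivative
    of [expZ G h] in [h] and [V = expZ G h - (1 - x)]. One edge lowers [expZ G h] on average by
    about [(2 / n) W (x - V)], and decreasing [h] by [2 x / n] raises it by about [(2 / n) W x].
    What is left is [(2 / n) W V]: the random [W] multiplies the deviation itself, so the crude
    bound [W <= 1 / h] suffices and nothing about the law of [W] has to be known. Up to the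
    threshold the value 0 takes the place of [rho_n], so (i) and (ii) are one statement. The bound
    on [s_3] bounds [s_2], which leaves [F] only [O(n)] edges, and in (iv) it keeps the explicit
    bounds at a fixed distance from [rho_n]. *)

Lemma expR_ge1DxD2 y : 0 <= y -> 1 + y + y ^+ 2 / 2 <= expR y.
Proof.
move=> y0.
pose f (z : R) : R := expR z - (1 + z + z ^+ 2 / 2).
have dF (x : R) : is_derive x 1 f (expR x - (1 + x)).
  by apply: is_derive_eq; rewrite /GRing.scale/=; lra.
have cF : {within `[0, y], continuous f}.
  by apply: derivable_within_continuous => x _; exact: ex_derive.
have [x _] := MVT_segment y0 (fun x _ => dF x) cF.
rewrite /f expR0 => H; have := expR_ge1Dx x; nra.
Qed.

Lemma expRN_le2 y : 0 <= y -> expR (- y) <= 1 - y + y ^+ 2 / 2.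
Proof.
move=> y0; rewrite expRN -[leLHS]mul1r ler_pdivrMr ?expR_gt0//.
have q0 : 0 <= 1 - y + y ^+ 2 / 2.
  by have := sqr_ge0 (y - 1); rewrite sqrrB1; lra.
apply: le_trans (ler_wpM2l q0 (expR_ge1DxD2 y0)).
have -> : (1 - y + y ^+ 2 / 2) * (1 + y + y ^+ 2 / 2) = 1 + (y ^+ 2 / 2) ^+ 2 by field.
by rewrite lerDl sqr_ge0.
Qed.

Lemma expRN_ge3 y : 0 <= y -> 1 - y + y ^+ 2 / 2 - y ^+ 3 / 6 <= expR (- y).
Proof.
move=> y0.
pose f (z : R) : R := expR (- z) - (1 - z + z ^+ 2 / 2 - z ^+ 3 / 6).
have dF (x : R) : is_derive x 1 f (1 - x + x ^+ 2 / 2 - expR (- x)).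
  by apply: is_derive_eq; rewrite /GRing.scale/=; lra.
have cF : {within `[0, y], continuous f}.
  by apply: derivable_within_continuous => x _; exact: ex_derive.
have [x xy] := MVT_segment y0 (fun x _ => dF x) cF.
have x0 : 0 <= x by move: xy; rewrite in_itv/= => /andP[].
rewrite /f oppr0 expR0 => H; have := expRN_le2 x0; nra.
Qed.

Lemma mul_expRN_le1 y : 0 <= y -> y * expR (- y) <= 1.
Proof.
move=> y0; rewrite expRN ler_pdivrMr ?expR_gt0// mul1r.
by have := expR_ge1Dx y; lra.
Qed.

Lemma sqr_mul_expRN_le2 y : 0 <= y -> y ^+ 2 * expR (- y) <= 2.
Proof.
move=> y0; rewrite expRN ler_pdivrMr ?expR_gt0//.
by have := expR_ge1DxD2 y0; lra.
Qed.

Lemma oneB_expRN_le y : 1 - expR (- y) <= y.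
Proof. by have := expR_ge1Dx (- y); lra. Qed.

Lemma oneB_expRN_ge0 y : 0 <= y -> 0 <= 1 - expR (- y).
Proof. by move=> y0; rewrite subr_ge0 expR_le1 oppr_le0. Qed.

(** Dividing the equation [rho = 1 - expZ F (rho * t)] by [rho * t] turns it into: the average of
    [rate] at [rho * t] is [1 / t]. Monotonicity in [a] then gives uniqueness and stability of the
    root. *)
Definition rate (c : nat) a : R := (1 - expR (- (a * c%:R))) / a.

Lemma rate_geom (c : nat) a : rate c a = rate 1 a * \sum_(i < c) expR (- a) ^+ i.
Proof.
rewrite /rate mulrAC; congr (_ / _); rewrite mulr1 -mulNr expRM_natr.
by apply: oppr_inj; rewrite opprB subrX1 -mulNr opprB.
Qed.

Lemma rate_ge0 (c : nat) a : 0 < a -> 0 <= rate c a.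
Proof.
move=> a0; apply: divr_ge0; last exact: ltW.
by apply: oneB_expRN_ge0; rewrite mulr_ge0// ltW.
Qed.

Lemma rate_le (c : nat) a : 0 < a -> rate c a <= c%:R.
Proof.
by move=> a0; rewrite /rate ler_pdivrMr// [leRHS]mulrC; exact: oneB_expRN_le.
Qed.

(** With [p = exp (- a)] and [q = exp (- (b - a))], the numerator over [a b] is [(b - a) (1 - p (1 +
    a)) + a p ((b - a) - (1 - q))]. The second term is nonnegative and the first is at least
    [(b - a) p a ^ 2 / 2]. The bound is weak when [a] is much smaller than [b]. *)
Lemma rate1_decr_near a b : 0 < a -> a <= b ->
  (b - a) * expR (- a) * a / (2 * b) <= rate 1 a - rate 1 b.
Proof.
move=> a0 ab; have b0 : 0 < b by exact: lt_le_trans ab.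
rewrite /rate !mulr1 -subr_ge0.
have -> : (1 - expR (- a)) / a - (1 - expR (- b)) / b
    - (b - a) * expR (- a) * a / (2 * b) =
  (b * (1 - expR (- a)) - a * (1 - expR (- b))
    - (b - a) * expR (- a) * a ^+ 2 / 2) / (a * b).
  by field; rewrite !gt_eqF.
apply: divr_ge0; last by rewrite mulr_ge0// ltW.
have -> : expR (- b) = expR (- a) * expR (- (b - a)).
  by rewrite -expRD; congr expR; ring.
have := oneB_expRN_le (b - a).
have : expR (- a) * (1 + a + a ^+ 2 / 2) <= 1.
  rewrite -ler_pdivlMl ?expR_gt0// -expRN opprK mulr1.
  by apply: expR_ge1DxD2; exact: ltW.
have := expR_gt0 (- a).
set p := expR (- a); set q := expR (- (b - a)) => p0 H1 H2.
have : 0 <= (b - a) * (1 - p * (1 + a + a ^+ 2 / 2)) by rewrite mulr_ge0; lra.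
have : 0 <= a * p * (b - a - (1 - q)) by rewrite !mulr_ge0; lra.
by lra.
Qed.

Lemma rate1_anti a b : 0 < a -> a <= b -> rate 1 b <= rate 1 a.
Proof.
move=> a0 ab; rewrite -subr_ge0; apply: le_trans (rate1_decr_near a0 ab).
have b0 : 0 < b by exact: lt_le_trans ab.
by rewrite !mulr_ge0 ?invr_ge0 ?expR_ge0 ?subr_ge0 ?mulr_ge0 ?(ltW a0) ?(ltW b0).
Qed.

(** For [a >= b / 2] the factor [a / (2 b)] of [rate1_decr_near] is at least [1 / 4]. For smaller
    [a], comparison with the midpoint [b / 2] costs another factor 2, hence the 8. *)
Lemma rate1_decr (B a b : R) : 0 < a -> a <= b -> b <= B ->
  expR (- B) / 8 * (b - a) <= rate 1 a - rate 1 b.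
Proof.
move=> a0 ab bB; have b0 : 0 < b by exact: lt_le_trans ab.
have near (a' : R) : b / 2 <= a' -> a' <= b ->
    expR (- B) / 4 * (b - a') <= rate 1 a' - rate 1 b.
  move=> ba a'b; have a'0 : 0 < a' by lra.
  apply: le_trans (rate1_decr_near a'0 a'b).
  rewrite [leLHS]mulrC -!mulrA ler_wpM2l; [by []|lra|].
  have h : 4^-1 <= a' / (2 * b) by rewrite ler_pdivlMr; lra.
  have e0 : 0 < expR (- B) by exact: expR_gt0.
  have e1 : expR (- B) <= expR (- a') by rewrite ler_expR; lra.
  by apply: ler_pM => //; lra.
have e0 : 0 < expR (- B) by exact: expR_gt0.
have [ba|ba] := lerP (b / 2) a.
  apply: le_trans (near a ba ab); rewrite ler_wpM2r; lra.
have h1 : rate 1 (b / 2) <= rate 1 a by apply: rate1_anti; lra.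
have := near (b / 2) (lexx _); rewrite ler_pdivrMr; last lra.
have h2 : 0 <= expR (- B) * a by rewrite mulr_ge0; lra.
by move=> /(_ ltac:(lra)); lra.
Qed.

(* By [rate_geom], [rate c] is [rate 1] times a decreasing function of [a]
   which is at least 1. *)
Lemma rate_decr (c : nat) (B a b : R) : (0 < c)%N -> 0 < a -> a <= b -> b <= B ->
  expR (- B) / 8 * (b - a) <= rate c a - rate c b.
Proof.
move=> c0 a0 ab bB; apply: le_trans (rate1_decr a0 ab bB) _.
have b0 : 0 < b by exact: lt_le_trans ab.
rewrite (rate_geom c a) (rate_geom c b).
have hS : \sum_(i < c) expR (- b) ^+ i <= \sum_(i < c) expR (- a) ^+ i.
  by apply: ler_sum => i _; rewrite lerXn2r ?nnegrE ?expR_ge0// ler_expR lerN2.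
have h1 : 1 <= \sum_(i < c) expR (- b) ^+ i.
  case: c c0 {hS} => // c _; rewrite big_ord_recl expr0 lerDl.
  by apply: sumr_ge0 => i _; rewrite exprn_ge0// expR_ge0.
have := rate1_anti a0 ab; have := rate_ge0 1 b0; have := rate_ge0 1 a0.
move: (rate 1 a) (rate 1 b) (\sum_(i < c) _) (\sum_(i < c) _) hS h1.
by move=> ra rb Sa Sb h1 h2 h3 h4 h5; nra.
Qed.

End Exponential.

(** * Components of a graph and the effect of one new edge *)

Section Components.
Variable n : nat.
Implicit Types (G H : graph n) (a b v : 'I_n).

Definition csize G v : nat := #|comp G v|.

Lemma adj_sym G : symmetric (adj G).
Proof. by move=> x y; rewrite /adj eq_sym setUC. Qed.

Lemma connect_adj_sym G : connect_sym (adj G).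
Proof. by apply: sym_connect_sym; exact: adj_sym. Qed.

Lemma mem_comp G v : v \in comp G v.
Proof. by rewrite inE connect0. Qed.

Lemma csize_gt0 G v : (0 < csize G v)%N.
Proof. by apply/card_gt0P; exists v; exact: mem_comp. Qed.

Lemma csize_le G v : (csize G v <= n)%N.
Proof. by rewrite /csize -[X in (_ <= X)%N]card_ord max_card. Qed.

Lemma comp_eq G a b : connect (adj G) a b -> comp G a = comp G b.
Proof.
move=> ab; apply/setP => y; rewrite !inE.
by apply: (same_connect (@connect_adj_sym G) ab).
Qed.

Lemma mem_comp_eq G a v : v \in comp G a -> comp G v = comp G a.
Proof. by rewrite inE => /comp_eq ->. Qed.

Lemma comp_eqE G a v : (comp G v == comp G a) = (v \in comp G a).
Proof.
apply/eqP/idP => [<-|]; first exact: mem_comp.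
exact: mem_comp_eq.
Qed.

Lemma adjU G e : subrel (adj G) (adj (e |: G)).
Proof. by move=> x y /andP[xy xG]; rewrite /adj xy inE xG orbT. Qed.

Lemma comp_sub G H v : G \subset H -> comp G v \subset comp H v.
Proof.
move=> GH; apply/subsetP => y; rewrite !inE; apply: connect_sub => x z.
by move=> /andP[xz /(subsetP GH) xH]; apply: connect1; rewrite /adj xz.
Qed.

(** The new edge has both ends in the union, so the union and every other old component are closed
    under the new adjacency. The cases [a = b] and [a], [b] already connected are included. *)
Lemma compU1 G a b v :
  comp ([set a; b] |: G) v =
  if v \in comp G a :|: comp G b then comp G a :|: comp G b else comp G v.
Proof.
set G' := _ |: G; set A := comp G a :|: comp G b.
have subG x y : connect (adj G) x y -> connect (adj G') x y.
  by apply: connect_sub => {}x {}y xy; apply: connect1; exact: adjU.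
have abG' : connect (adj G') a b.
  have [->|ab] := eqVneq a b; first exact: connect0.
  by apply: connect1; rewrite /adj ab !inE eqxx.
have inA x : (x \in A) = connect (adj G) a x || connect (adj G) b x.
  by rewrite !inE.
have G'sym := @connect_adj_sym G'.
have edgeP x y : adj G' x y -> adj G x y \/ (x \in [set a; b] /\ y \in [set a; b]).
  move=> /andP[xy]; rewrite !inE => /orP[/eqP e|xG]; last by left; rewrite /adj xy.
  by right; rewrite -!in_set2 -e !inE !eqxx orbT.
have stepA x : x \in [set a; b] -> x \in A.
  by rewrite inA !inE => /orP[]/eqP->; rewrite connect0 ?orbT.
have [vA|vA] := ifPn; apply/setP => y; rewrite [LHS]inE.
  apply/idP/idP => [vy|yA]; last first.
    have aA x : x \in A -> connect (adj G') a x.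
      rewrite inA => /orP[|] /subG // bx.
      exact: connect_trans bx.
    by apply: connect_trans (aA _ yA); rewrite G'sym aA.
  have clA : fingraph.closed (adj G') (mem A).
    apply: intro_closed => // x z /edgeP[xz|[_ /stepA]]//.
    rewrite !inE => /orP[] xA; rewrite (connect_trans xA (connect1 xz)) ?orbT//.
  by rewrite -(closed_connect clA vy).
apply/idP/idP => [vy|]; last by rewrite inE; exact: subG.
have clv : fingraph.closed (adj G') (mem (comp G v)).
  apply: intro_closed => // x z /edgeP[xz|[xab _]].
    by rewrite !inE => vx; exact: connect_trans (connect1 xz).
  rewrite inE connect_adj_sym => xv; case/negP: vA.
  by move: xab; rewrite inA !inE => /orP[]/eqP <-; rewrite xv ?orbT.
by rewrite -(closed_connect clv vy) mem_comp.
Qed.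

Lemma csize_le_C1 G v : (csize G v <= C1 G)%N.
Proof.
have : comp G v \in comps G by exact: imset_f.
exact: (@leq_bigmax_cond _ _ (fun C : {set 'I_n} => #|C|)).
Qed.

Lemma C1_attained G : (0 < n)%N -> exists v, C1 G = csize G v.
Proof.
move=> n0; have c0 : (0 < #|comps G|)%N.
  by apply/card_gt0P; exists (comp G (Ordinal n0)); exact: imset_f.
have [C /imsetP[v _ ->] e] := eq_bigmax_cond (fun C : {set 'I_n} => #|C|) c0.
by exists v.
Qed.

Lemma C1_sub G H : (0 < n)%N -> G \subset H -> (C1 G <= C1 H)%N.
Proof.
move=> n0 GH; have [v ->] := C1_attained G n0.
apply: leq_trans (csize_le_C1 H v).
exact/subset_leq_card/comp_sub.
Qed.

Lemma C1_le G : (0 < n)%N -> (C1 G <= n)%N.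
Proof. by move=> n0; have [v ->] := C1_attained G n0; exact: csize_le. Qed.

Lemma in_pairs (e : {set 'I_n}) : (e \in pairs n) = (#|e| == 2%N).
Proof. by rewrite inE. Qed.

(** Every edge joins two vertices of one component, so ordered pairs of connected vertices cover the
    edges. The right-hand side is [n s_2]: a bounded [s_2] leaves almost all pairs absent from the
    initial graph. *)
Lemma simple_graph_card_le G :
  simple_graph G -> (#|G| <= \sum_v csize G v)%N.
Proof.
move=> simG.
pose P := [set p : 'I_n * 'I_n | p.2 \in comp G p.1].
have : G \subset [set [set p.1; p.2] | p in P].
  apply/subsetP => e eG; have := subsetP simG _ eG.
  rewrite in_pairs => /cards2P[x [y [xy ee]]]; apply/imsetP; exists (x, y) => //=.
  by rewrite !inE /=; apply: connect1; rewrite /adj xy -ee.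
move=> /subset_leq_card/leq_trans; apply.
apply: leq_trans (leq_imset_card _ _) _.
rewrite -sum1_card (eq_bigl (fun p : 'I_n * 'I_n => p.2 \in comp G p.1)); last first.
  by move=> p; rewrite inE.
rewrite -(pair_big_dep xpredT (fun x y => y \in comp G x) (fun _ _ => 1%N))/=.
by apply: leq_sum => v _; rewrite sum1_card.
Qed.

Lemma card_pairs : #|pairs n| = 'C(n, 2).
Proof. by rewrite /pairs card_draws card_ord. Qed.

Section Sums.
Variable R : realType.
Implicit Types psi : nat -> R.

Definition vsum psi G : R := \sum_v psi (csize G v).

Lemma Sk_vsum k G : Sk k.+1 G = vsum (fun c => (c ^ k)%:R) G.
Proof.
rewrite /Sk /vsum.
rewrite (partition_big (comp G) (mem (comps G))) /=; last first.
  by move=> v _; exact: imset_f.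
apply: eq_bigr => C /imsetP[x _ ->].
rewrite (eq_bigl (mem (comp G x))); last by move=> v; rewrite comp_eqE.
rewrite (eq_bigr (fun=> (#|comp G x| ^ k)%:R)); last first.
  by move=> v vx; rewrite /csize (mem_comp_eq vx).
by rewrite sumr_const expnS natrM mulr_natl.
Qed.

(** A component of size [c] contributes [c * psi c] to [vsum psi]; this is the change when
    components of sizes [p] and [q] merge. *)
Definition jump psi (p q : nat) : R :=
  (p + q)%:R * psi (p + q)%N - p%:R * psi p - q%:R * psi q.

Lemma vsum_eq psi G H : comp G =1 comp H -> vsum psi G = vsum psi H.
Proof. by move=> GH; apply: eq_bigr => v _; rewrite /csize GH. Qed.

Lemma vsum_connect psi G a b : connect (adj G) a b ->
  vsum psi ([set a; b] |: G) = vsum psi G.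
Proof.
move=> ab; apply: vsum_eq => v; rewrite compU1 (comp_eq ab) setUid.
by case: ifPn => // /mem_comp_eq ->.
Qed.

Lemma vsum_comp psi G a :
  \sum_(v in comp G a) psi (csize G v) = (csize G a)%:R * psi (csize G a).
Proof.
rewrite (eq_bigr (fun=> psi (csize G a))); last first.
  by move=> v va; rewrite /csize (mem_comp_eq va).
by rewrite sumr_const mulr_natl.
Qed.

Lemma vsum_merge psi G a b : ~~ connect (adj G) a b ->
  vsum psi ([set a; b] |: G) = vsum psi G + jump psi (csize G a) (csize G b).
Proof.
move=> nab; set A := comp G a :|: comp G b.
have dAB : [disjoint comp G a & comp G b].
  rewrite -setI_eq0; apply/eqP/setP => y; rewrite !inE.
  apply/negbTE; apply: contra nab => /andP[ay yb].
  by apply: connect_trans ay _; rewrite connect_adj_sym.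
have cA : #|A| = (csize G a + csize G b)%N.
  by apply/eqP; rewrite -(leq_card_setU (comp G a) (comp G b)).2 in dAB *.
rewrite /vsum (bigID (mem A))/= [in RHS](bigID (mem A))/=.
rewrite (eq_bigr (fun=> psi #|A|)); last first.
  by move=> v vA; rewrite /csize compU1 -/A vA.
rewrite sumr_const -[X in X + _ = _]mulr_natl cA.
rewrite [X in _ + X = _](eq_bigr (fun v => psi (csize G v))); last first.
  by move=> v vA; rewrite /csize compU1 -/A (negbTE vA).
rewrite [X in _ = X + _ + _](_ : _ = (csize G a)%:R * psi (csize G a)
   + (csize G b)%:R * psi (csize G b)); last first.
  rewrite -!vsum_comp -bigU//; apply: eq_bigl => v.
  by rewrite !inE.
by rewrite /jump; ring.
Qed.

Lemma sum_pairs (f : {set 'I_n} -> R) :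
  \sum_a \sum_(b | a != b) f [set a; b] = 2 * \sum_(e in pairs n) f e.
Proof.
rewrite (pair_big_dep xpredT (fun a b => a != b) (fun a b => f [set a; b]))/=.
rewrite (partition_big (fun p : 'I_n * 'I_n => [set p.1; p.2]) (mem (pairs n)))/=; last first.
  by move=> p pp; rewrite in_pairs cards2 pp.
rewrite big_distrr/=; apply: eq_bigr => e; rewrite in_pairs => /cards2P[x [y [xy ->]]].
rewrite (eq_bigr (fun=> f [set x; y])); last by move=> p /andP[_ /eqP ->].
rewrite sumr_const -[LHS]mulr_natl; congr (_%:R * _).
transitivity #|[set (x, y); (y, x)]|.
  apply: eq_card => -[u v]; rewrite !inE /= !xpair_eqE.
  apply/andP/orP => [[uv /eqP/setP e1]|[]/andP[/eqP-> /eqP->]]; last 2 first.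
  - by rewrite xy.
  - by rewrite eq_sym xy setUC.
  have := e1 u; have := e1 v; rewrite !inE !eqxx ?orbT/=.
  move=> /esym/orP[]/eqP ev /esym/orP[]/eqP eu; move: uv; rewrite eu ev ?eqxx//.
  - by right.
  - by left.
by rewrite cards2 xpair_eqE negb_and xy.
Qed.

(** The generator of the edge-adding chain without its rate, which is the only part that depends on
    the model. *)
Definition edge_gen (f : graph n -> R) G : R :=
  \sum_(e in pairs n) (f (e |: G) - f G).

Lemma edge_gen_vsum psi G :
  edge_gen (vsum psi) G =
  2^-1 * \sum_a \sum_(b | ~~ connect (adj G) a b) jump psi (csize G a) (csize G b).
Proof.
apply: (@mulfI _ 2); first by rewrite pnatr_eq0.
rewrite mulrA divff ?pnatr_eq0// mul1r -sum_pairs; apply: eq_bigr => a _.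
rewrite (bigID (fun b => connect (adj G) a b))/= big1 ?add0r; last first.
  by move=> b /andP[_ ab]; rewrite vsum_connect// subrr.
rewrite (eq_bigl (fun b => ~~ connect (adj G) a b)); last first.
  by move=> b; case: eqVneq => //= <-; rewrite connect0.
by apply: eq_bigr => b ab; rewrite vsum_merge// addrC addKr.
Qed.

End Sums.
End Components.

(** * The size generating function and the equation for the giant fraction *)

Section SizeGeneratingFunction.
Variables (R : realType) (n : nat).
Hypothesis n_gt0 : (0 < n)%N.
Implicit Types (F : graph n) (a b t rho x h s : R).

Let n_neq0 : (n%:R : R) != 0. Proof. by rewrite pnatr_eq0 -lt0n. Qed.
Let n_ge0 : 0 <= (n%:R : R)^-1. Proof. by rewrite invr_ge0. Qed.

Lemma avg_cst (c : R) : n%:R^-1 * \sum_(v < n) c = c.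
Proof. by rewrite sumr_const card_ord -[X in _ * X]mulr_natl mulKf. Qed.

Lemma ler_avg (f g : 'I_n -> R) : (forall v, f v <= g v) ->
  n%:R^-1 * \sum_v f v <= n%:R^-1 * \sum_v g v.
Proof. by move=> fg; rewrite ler_wpM2l//; apply: ler_sum. Qed.

Lemma sk_avg k F : sk k.+1 F = n%:R^-1 * \sum_v (csize F v)%:R ^+ k :> R.
Proof.
rewrite /sk Sk_vsum mulrC; congr (_ * _).
by apply: eq_bigr => v _; rewrite natrX.
Qed.

Lemma sk_mono j k F : (j <= k)%N -> sk j.+1 F <= sk k.+1 F :> R.
Proof.
move=> jk; rewrite !sk_avg; apply: ler_avg => v; rewrite ler_weXn2l//.
by rewrite ler1n csize_gt0.
Qed.

Lemma sk_ge1 k F : 1 <= sk k.+1 F :> R.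
Proof.
rewrite -[leLHS]avg_cst sk_avg; apply: ler_avg => v.
by rewrite exprn_ege1// ler1n csize_gt0.
Qed.

Lemma expZ_vsum F a : expZ F a = n%:R^-1 * vsum (fun c => expR (- (a * c%:R))) F.
Proof. by []. Qed.

Lemma oneB_expZ F a :
  1 - expZ F a = n%:R^-1 * \sum_v (1 - expR (- (a * (csize F v)%:R))).
Proof. by rewrite sumrB mulrBr avg_cst. Qed.

Lemma expZ_gt0 F a : 0 < expZ F a.
Proof.
rewrite mulr_gt0 ?invr_gt0 ?ltr0n// (bigD1 (Ordinal n_gt0))//=.
by rewrite ltr_wpDr ?expR_gt0//; apply: sumr_ge0 => v _; exact: expR_ge0.
Qed.

Lemma expZ_le1 F a : 0 <= a -> expZ F a <= 1.
Proof.
move=> a0; rewrite -[leRHS]avg_cst; apply: ler_avg => v.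
by rewrite expR_le1 oppr_le0 mulr_ge0.
Qed.

Lemma oneB_expZ_ge F a : 0 <= a ->
  a * sk 2 F - a ^+ 2 * sk 3 F / 2 <= 1 - expZ F a.
Proof.
move=> a0; rewrite oneB_expZ !sk_avg -subr_ge0.
have -> : n%:R^-1 * \sum_v (1 - expR (- (a * (csize F v)%:R)))
   - (a * (n%:R^-1 * \sum_v (csize F v)%:R ^+ 1)
      - a ^+ 2 * (n%:R^-1 * \sum_v (csize F v)%:R ^+ 2) / 2)
  = n%:R^-1 * \sum_v ((1 - expR (- (a * (csize F v)%:R)))
     - (a * (csize F v)%:R - (a * (csize F v)%:R) ^+ 2 / 2)).
  rewrite [in RHS]sumrB [X in _ = _ * (_ - X)]sumrB.
  rewrite [X in _ = _ * (_ - (X - _))](_ : _ = a * \sum_v (csize F v)%:R ^+ 1); last first.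
    by rewrite big_distrr/=; apply: eq_bigr => v _; rewrite expr1.
  rewrite [X in _ = _ * (_ - (_ - X))](_ : _ = a ^+ 2 / 2 * \sum_v (csize F v)%:R ^+ 2); last first.
    by rewrite big_distrr/=; apply: eq_bigr => v _; rewrite exprMn mulrAC.
  by ring.
apply: mulr_ge0 => //; apply: sumr_ge0 => v _.
by have := @expRN_le2 R (a * (csize F v)%:R) (mulr_ge0 a0 (ler0n _ _)); lra.
Qed.

Lemma oneB_expZ_le F a : 0 <= a ->
  1 - expZ F a <= a * sk 2 F - a ^+ 2 * sk 3 F / 2 + a ^+ 3 * sk 4 F / 6.
Proof.
move=> a0; rewrite oneB_expZ !sk_avg -subr_ge0.
have -> : a * (n%:R^-1 * \sum_v (csize F v)%:R ^+ 1)
      - a ^+ 2 * (n%:R^-1 * \sum_v (csize F v)%:R ^+ 2) / 2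
      + a ^+ 3 * (n%:R^-1 * \sum_v (csize F v)%:R ^+ 3) / 6
   - n%:R^-1 * \sum_v (1 - expR (- (a * (csize F v)%:R)))
  = n%:R^-1 * \sum_v ((a * (csize F v)%:R - (a * (csize F v)%:R) ^+ 2 / 2
      + (a * (csize F v)%:R) ^+ 3 / 6) - (1 - expR (- (a * (csize F v)%:R)))).
  rewrite [in RHS]sumrB [X in _ = _ * (X - _)]big_split/= [X in _ = _ * (X + _ - _)]sumrB /=.
  rewrite [X in _ = _ * (X - _ + _ - _)](_ : _ = a * \sum_v (csize F v)%:R ^+ 1); last first.
    by rewrite big_distrr/=; apply: eq_bigr => v _; rewrite expr1.
  rewrite [X in _ = _ * (_ - X + _ - _)](_ : _ = a ^+ 2 / 2 * \sum_v (csize F v)%:R ^+ 2); last first.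
    by rewrite big_distrr/=; apply: eq_bigr => v _; rewrite exprMn mulrAC.
  rewrite [X in _ = _ * (_ + X - _)](_ : _ = a ^+ 3 / 6 * \sum_v (csize F v)%:R ^+ 3); last first.
    by rewrite big_distrr/=; apply: eq_bigr => v _; rewrite exprMn mulrAC.
  by ring.
apply: mulr_ge0 => //; apply: sumr_ge0 => v _.
by have := @expRN_ge3 R (a * (csize F v)%:R) (mulr_ge0 a0 (ler0n _ _)); lra.
Qed.

(** Equal to [(1 - expZ F a) / a] for [a > 0]; it decreases from its limit [sk 2 F] at 0. A positive
    root at time [t] corresponds to the value [1 / t], which explains the threshold
    [t > 1 / sk 2 F]. *)
Definition ravg F a : R := n%:R^-1 * \sum_v rate (csize F v) a.

Lemma oneB_expZ_ravg F a : 0 < a -> 1 - expZ F a = a * ravg F a.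
Proof.
move=> a0; rewrite oneB_expZ /ravg mulrCA; congr (_ * _); rewrite big_distrr/=.
by apply: eq_bigr => v _; rewrite /rate [RHS]mulrC mulfVK ?gt_eqF.
Qed.

Lemma ravg_decr F (B a b : R) : 0 < a -> a <= b -> b <= B ->
  expR (- B) / 8 * (b - a) <= ravg F a - ravg F b.
Proof.
move=> a0 ab bB; rewrite /ravg -mulrBr -sumrB -[leLHS]avg_cst.
by apply: ler_avg => v; apply: rate_decr => //; exact: csize_gt0.
Qed.

Lemma ravg_ltP F a b : 0 < a -> 0 < b -> (ravg F b < ravg F a) = (a < b).
Proof.
have lt a' b' : 0 < a' -> a' < b' -> ravg F b' < ravg F a'.
  move=> a0 ab; rewrite -subr_gt0; apply: lt_le_trans (ravg_decr F a0 (ltW ab) (lexx _)).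
  by rewrite !mulr_gt0 ?expR_gt0 ?subr_gt0.
move=> a0 b0; case: (ltgtP a b) => [ab|ba|->].
- exact: lt.
- by apply: lt_gtF; exact: lt.
- exact: ltxx.
Qed.

Lemma ravg_le_sk2 F a : 0 < a -> ravg F a <= sk 2 F.
Proof.
move=> a0; rewrite sk_avg; apply: ler_avg => v; rewrite expr1.
exact: rate_le.
Qed.

(** At 0 [rate] takes the default value of a division by zero, so the decrease is measured from
    [b / 2] instead. *)
Lemma ravg_le_sk2B F (B b : R) : 0 < b -> b <= B ->
  ravg F b <= sk 2 F - expR (- B) / 8 * b / 2.
Proof.
move=> b0 bB; have h : 0 < b / 2 by lra.
have := ravg_decr F h _ bB; have := ravg_le_sk2 F h => h1 h2.
have := h2 ltac:(lra); lra.
Qed.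

Lemma continuous_expZ F : continuous (expZ F : R -> R).
Proof.
move=> a; rewrite /expZ; apply: cvgM; first exact: cvg_cst.
apply: cvg_big => [|v _]; first exact: add_continuous.
apply: continuous_cvg; first exact: continuous_expR.
by apply: cvgN; apply: cvgM; [exact: cvg_id|exact: cvg_cst].
Qed.

(* The paper's [rho_n], extended by 0 up to the threshold [1 / sk 2 F]. *)
Definition giant_fraction F t rho : Prop :=
  (0 < rho /\ rho = 1 - expZ F (rho * t)) \/ (rho = 0 /\ t <= (sk 2 F)^-1).

Lemma giant_fraction_ge0 F t rho : giant_fraction F t rho -> 0 <= rho.
Proof. by case=> [[/ltW]|[->]]. Qed.

Lemma giant_fraction_le1 F t rho : giant_fraction F t rho -> rho <= 1.
Proof. by case=> [[_ ->]|[-> _]]//; have := expZ_gt0 F (rho * t); lra. Qed.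

Lemma root_ravg F t rho : 0 < t -> 0 < rho -> rho = 1 - expZ F (rho * t) ->
  ravg F (rho * t) = t^-1.
Proof.
move=> t0 r0; rewrite oneB_expZ_ravg ?mulr_gt0// => e.
apply: (mulfI (lt0r_neq0 r0)); apply: (mulIf (lt0r_neq0 t0)).
by rewrite mulfVK ?gt_eqF// mulrAC -e.
Qed.

Lemma giant_fraction_unique F t : 0 < t -> (sk 2 F)^-1 < t ->
  exists! rho : R, 0 < rho /\ rho = 1 - expZ F (rho * t).
Proof.
move=> t0 ht.
have s2 : 1 <= sk 2 F :> R by exact: sk_ge1.
have s3 : 1 <= sk 3 F :> R by exact: sk_ge1.
have ts2 : 1 < t * sk 2 F by rewrite -ltr_pdivrMr ?div1r// (lt_le_trans ltr01).
pose f r := (1 - expZ F (r * t)) - r.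
have f1 : f 1 <= 0 by rewrite /f; have := expZ_gt0 F (1 * t); lra.
(* The vertex of the parabola [r (t s_2 - 1) - r ^ 2 t ^ 2 s_3 / 2], which bounds [f] from below. A
   positive left endpoint keeps the intermediate value theorem away from the trivial root 0. *)
pose a0 := (t * sk 2 F - 1) / (t ^+ 2 * sk 3 F).
have s3p : 0 < sk 3 F :> R by lra.
have q0 : 0 < t ^+ 2 * sk 3 F by apply: mulr_gt0 => //; exact: exprn_gt0.
have a0p : 0 < a0 by apply: divr_gt0 => //; lra.
have fa0 : 0 <= f a0.
  rewrite /f subr_ge0.
  have a0t : 0 <= a0 * t by rewrite mulr_ge0// ltW.
  apply: le_trans (oneB_expZ_ge F a0t); rewrite -subr_ge0.
  have e : a0 * (t ^+ 2 * sk 3 F) = t * sk 2 F - 1.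
    by rewrite /a0 mulfVK// gt_eqF.
  have -> : a0 * t * sk 2 F - (a0 * t) ^+ 2 * sk 3 F / 2 - a0 =
    a0 * (t * sk 2 F - 1 - a0 * (t ^+ 2 * sk 3 F) / 2) by field.
  by rewrite e; apply: mulr_ge0; lra.
have a01 : a0 <= 1.
  rewrite leNgt; apply/negP => a01.
  by move: fa0; rewrite /f; have := expZ_gt0 F (a0 * t); lra.
have cf : {within `[a0, 1]%classic, continuous f}%classic.
  apply: continuous_subspaceT => r; rewrite /f.
  apply: cvgB; last exact: cvg_id.
  apply: cvgB; first exact: cvg_cst.
  apply: continuous_cvg; first exact: continuous_expZ.
  by apply: cvgM; [exact: cvg_id|exact: cvg_cst].
have [|r] := @IVT R f a0 1 0 a01 cf.
  by rewrite ge_min f1 orbT le_max fa0.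
rewrite in_itv/= => /andP[a0r _] fr.
have r0 : 0 < r by lra.
have er : r = 1 - expZ F (r * t) by move: fr; rewrite /f; lra.
exists r; split => // r' [r'0 er'].
have := ravg_ltP F (mulr_gt0 r0 t0) (mulr_gt0 r'0 t0).
have := ravg_ltP F (mulr_gt0 r'0 t0) (mulr_gt0 r0 t0).
rewrite !root_ravg// ltxx !ltr_pM2r// => h1 h2.
by apply/eqP; rewrite eq_le !leNgt -h1 -h2.
Qed.

(** The constant is half that of [ravg_decr] because of the case [rho = 0], where the decrease
    starts from [sk 2 F <= 1 / t] and is given by [ravg_le_sk2B]. *)
Lemma ravg_above F t rho B b : 0 < t -> giant_fraction F t rho ->
  rho * t < b -> b <= B -> ravg F b <= t^-1 - expR (- B) / 16 * (b - rho * t).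
Proof.
move=> t0 gf rb bB; have k0 := expR_gt0 (- B).
case: gf rb => [[r0 er] rb|[-> hs]].
  have := ravg_decr F (mulr_gt0 r0 t0) (ltW rb) bB.
  rewrite root_ravg// => h.
  have : 0 <= expR (- B) * (b - rho * t) by rewrite mulr_ge0; lra.
  by lra.
rewrite mul0r subr0 => b0; have := ravg_le_sk2B F b0 bB.
have : sk 2 F <= t^-1.
  by rewrite -[leLHS]invrK lef_pV2 ?posrE ?invr_gt0// (lt_le_trans _ (sk_ge1 _ _)).
by lra.
Qed.

Lemma ravg_below F t rho B b : 0 < t -> giant_fraction F t rho ->
  0 < b -> b <= rho * t -> rho * t <= B ->
  t^-1 + expR (- B) / 8 * (rho * t - b) <= ravg F b.
Proof.
move=> t0 gf b0 br rB; case: gf br rB => [[r0 er] br rB|[-> hs]]; last first.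
  by rewrite mul0r; lra.
by have := ravg_decr F b0 br rB; rewrite root_ravg//; lra.
Qed.

End SizeGeneratingFunction.

(** * Stability of the perturbed fixed-point equation, uniformly over graphs *)

Section FixedPoint.
Variable R : realType.

(* [x = 1 - expZ F (h + s * x)] is a perturbation of the equation defining the
   giant fraction at time [t]; the bound is uniform over all graphs because
   [rate] is uniformly steep. *)
Lemma fixed_point_stable (t eps : R) : 0 < t -> 0 < eps ->
  exists2 d : R, 0 < d & forall (n : nat) (F : graph n) (rho h s x : R),
    (0 < n)%N -> giant_fraction F t rho -> 0 < h -> h <= d -> `|s - t| <= d ->
    0 < x -> x <= 1 -> x = 1 - expZ F (h + s * x) -> `|x - rho| <= eps.
Proof.
move=> t0 e0.
have [k kE] : exists k : R, k = expR (- (t + 2)) / 16 by eexists.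
have k0 : 0 < k by rewrite kE divr_gt0 ?expR_gt0.
(* The first two entries give [b <= t + 2] and [s >= t / 2], the third makes [b - t * x] small
   against [t * eps], and the last two contradict [h6] in the two cases below. *)
pose d := Num.min (Num.min 1 (t / 2)) (Num.min (t * eps / 4)
  (Num.min (k * t ^+ 3 * eps ^+ 2 / 16) (k * t ^+ 3 * eps / 16))).
have t3 : 0 < t ^+ 3 by exact: exprn_gt0.
have te : 0 < t * eps by exact: mulr_gt0.
have kte : 0 < k * t ^+ 3 * eps by do 2!apply: mulr_gt0 => //.
have kte2 : 0 < k * t ^+ 3 * eps ^+ 2.
  by apply: mulr_gt0; [exact: mulr_gt0|exact: exprn_gt0].
have d0 : 0 < d by rewrite /d !lt_min; do ?[apply/andP; split]; lra.
have [d1 dt dte dk2 dk1] : [/\ d <= 1, d <= t / 2, d <= t * eps / 4,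
    d <= k * t ^+ 3 * eps ^+ 2 / 16 & d <= k * t ^+ 3 * eps / 16].
  by rewrite /d; split; rewrite !ge_min !lexx ?orbT.
have kt0 : 0 < k * (t * eps) by exact: mulr_gt0.
clearbody d; clear kte kte2.
exists d => // n F rho h s x n0 gf h0 hd; rewrite ler_norml => /andP[std1 std2].
move=> x0 x1 ex.
have rho0 := giant_fraction_ge0 gf; have rho1 := giant_fraction_le1 n0 gf.
have sx0 : 0 <= s * x by apply: mulr_ge0; lra.
pose b := h + s * x.
have b0 : 0 < b by rewrite /b; lra.
have exb : x = b * ravg F b by rewrite -oneB_expZ_ravg.
have dx : d * x <= d by rewrite ler_piMr// ltW.
have lo : (t - d) * x <= s * x by rewrite ler_wpM2r ?(ltW x0)//; lra.
have hi : s * x <= (t + d) * x by rewrite ler_wpM2r ?(ltW x0)//; lra.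
have tx : t * x <= t by rewrite ler_piMr// ltW.
have bB : b <= t + 2 by rewrite /b; lra.
have r0 : 0 <= ravg F b.
  by rewrite mulr_ge0// ?invr_ge0//; apply: sumr_ge0 => v _; exact: rate_ge0.
have tV : t * t^-1 = 1 by rewrite divff// gt_eqF.
have tV0 : 0 < t^-1 by rewrite invr_gt0.
(* If [x] misses [rho] by more than [eps], then [b] misses [rho * t] by at least [t * eps / 2] on
   the same side, so [ravg F b] differs from [1 / t] by order [eps]. This is incompatible with
   [x = b * ravg F b] and [b] close to [t * x]. *)
rewrite ler_norml; apply/andP; split; rewrite leNgt; apply/negP => hx.
  have rt : rho * t <= t by rewrite ler_piMl// ltW.
  have gap : t * eps / 2 <= rho * t - b.
    have : 0 <= t * (rho - eps - x) by rewrite mulr_ge0; lra.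
    by rewrite /b; lra.
  have h1 : t^-1 + 2 * k * (rho * t - b) <= ravg F b.
    have -> : 2 * k = expR (- (t + 2)) / 8 by rewrite kE; lra.
    by apply: ravg_below => //; lra.
  have h2 : t^-1 + k * (t * eps) <= ravg F b.
    apply: le_trans h1; rewrite lerD2l.
    have : 0 <= k * (rho * t - b - t * eps / 2) by rewrite mulr_ge0; lra.
    by lra.
  have h3 : (t - d) * x * (t^-1 + k * (t * eps)) <= x.
    rewrite [leRHS]exb; apply: ler_pM => //.
    - by apply: mulr_ge0; lra.
    - by apply: addr_ge0; exact: ltW.
    - by rewrite /b; lra.
  have h4 : (t - d) * (t^-1 + k * (t * eps)) <= 1.
    by rewrite -(ler_pM2r x0) mul1r mulrAC.
  have h5 : t / 2 * (k * (t * eps)) <= d * t^-1.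
    have : t / 2 * (k * (t * eps)) <= (t - d) * (k * (t * eps)).
      by rewrite ler_wpM2r ?(ltW kt0)//; lra.
    by lra.
  have h6 : k * t ^+ 3 * eps / 2 <= d.
    have -> : k * t ^+ 3 * eps / 2 = t / 2 * (k * (t * eps)) * t by field.
    by rewrite -ler_pdivlMr.
  by lra.
have gap : t * eps / 2 <= b - rho * t.
  have : 0 <= t * (x - (rho + eps)) by rewrite mulr_ge0; lra.
  by rewrite /b; lra.
have h1 : ravg F b <= t^-1 - k * (b - rho * t).
  by rewrite kE; apply: ravg_above => //; lra.
have h2 : ravg F b <= t^-1 - k * (t * eps) / 2.
  apply: le_trans h1 _; rewrite lerD2l lerN2.
  have : 0 <= k * (b - rho * t - t * eps / 2) by rewrite mulr_ge0; lra.
  by lra.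
have h3 : x <= (t * x + 2 * d) * (t^-1 - k * (t * eps) / 2).
  rewrite [leLHS]exb; apply: ler_pM => //; first exact: ltW.
  by rewrite /b; lra.
have h4 : t * x * (k * (t * eps) / 2) <= 2 * d * t^-1.
  have : 0 <= 2 * d * (k * (t * eps) / 2).
    by rewrite mulr_ge0 ?divr_ge0 ?(ltW kt0)// mulr_ge0 ?(ltW d0).
  have : t * x * t^-1 = x by rewrite mulrAC tV mul1r.
  by lra.
have h5 : t * eps * (k * (t * eps) / 2) <= t * x * (k * (t * eps) / 2).
  rewrite ler_wpM2r ?divr_ge0 ?(ltW kt0)//.
  by rewrite ler_pM2l//; lra.
have h6 : k * t ^+ 3 * eps ^+ 2 / 2 <= 2 * d.
  have -> : k * t ^+ 3 * eps ^+ 2 / 2 = t * eps * (k * (t * eps) / 2) * t by field.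
  by rewrite -ler_pdivlMr//; apply: le_trans h5 h4.
by lra.
Qed.

End FixedPoint.

(** * Explicit bounds on the giant fraction in terms of [s_2], [s_3], [s_4] *)

Section SurvivalBounds.
Variables (R : realType) (n : nat) (F : graph n) (t rho : R).
Hypotheses (n_gt0 : (0 < n)%N) (t_gt0 : 0 < t).
Hypotheses (rho_gt0 : 0 < rho) (rhoE : rho = 1 - expZ F (rho * t)).
Let s2 : R := sk 2 F.
Let s3 : R := sk 3 F.
Let s4 : R := sk 4 F.
Let delta := t - s2^-1.
Hypothesis delta_gt0 : 0 < delta.
Let lead := 2 * delta * (s2 ^+ 3 / s3).
Let y := delta * s2.

Let s2_ge1 : 1 <= s2. Proof. exact: sk_ge1. Qed.
Let s3_ge1 : 1 <= s3. Proof. exact: sk_ge1. Qed.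
Let s4_ge1 : 1 <= s4. Proof. exact: sk_ge1. Qed.
Let s2_neq0 : s2 != 0. Proof. by rewrite gt_eqF// (lt_le_trans ltr01). Qed.
Let s3_neq0 : s3 != 0. Proof. by rewrite gt_eqF// (lt_le_trans ltr01). Qed.
Let y_gt0 : 0 < y. Proof. by rewrite mulr_gt0// (lt_le_trans ltr01). Qed.
Let tE : t = (1 + y) / s2.
Proof. by rewrite /y /delta; field. Qed.
Let y1_neq0 : 1 + y != 0. Proof. by rewrite gt_eqF// addr_gt0. Qed.

(** The quadratic lower bound on [1 - expZ], divided by [rho], reads
    [t s_2 - 1 <= rho t ^ 2 s_3 / 2], and [y = t s_2 - 1]. Keeping [1 / (1 + y) ^ 2] rather than
    [1 - 2 y] preserves the margin needed for (iv). *)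
Lemma survival_lower : lead / (1 + y) ^+ 2 <= rho.
Proof.
have rt0 : 0 <= rho * t by rewrite mulr_ge0// ltW.
have := oneB_expZ_ge n_gt0 F rt0; rewrite -rhoE -/s2 -/s3 => h.
have h1 : t * s2 - 1 <= rho * (t ^+ 2 * s3 / 2).
  by rewrite -(ler_pM2l rho_gt0); move: h; lra.
have ts2 : t * s2 - 1 = y by rewrite tE mulfVK// addrC addKr.
rewrite ts2 in h1.
have t20 : 0 < t ^+ 2 * s3 / 2.
  apply: divr_gt0 => //; apply: mulr_gt0; first exact: exprn_gt0.
  exact: lt_le_trans ltr01 s3_ge1.
rewrite -ler_pdivrMr// in h1; apply: le_trans h1.
rewrite le_eqVlt; apply/orP; left; apply/eqP.
rewrite /lead {1}tE /y; field.
by rewrite -/y y1_neq0 s2_neq0 s3_neq0.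
Qed.

Let ratio := s2 ^+ 2 * s4 / s3 ^+ 2.
Hypothesis ratio_le : delta * ratio <= 3 / 8.

(** At the claimed bound [r0] the cubic upper bound gives [1 - expZ F (r0 * t) <= r0], that is [ravg
    F (r0 * t) <= 1 / t = ravg F (rho * t)]; since [ravg] decreases, [rho <= r0]. *)
Lemma survival_upper : rho <= lead * (1 + 8 / 3 * delta * ratio) / (1 + y).
Proof.
pose q := 2 / 3 * (delta * ratio).
have s20 : 0 < s2 by exact: lt_le_trans ltr01 s2_ge1.
have s30 : 0 < s3 by exact: lt_le_trans ltr01 s3_ge1.
have s40 : 0 < s4 by exact: lt_le_trans ltr01 s4_ge1.
have lead0 : 0 < lead.
  apply: mulr_gt0; first exact: mulr_gt0.
  by apply: divr_gt0 => //; exact: exprn_gt0.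
have q0 : 0 < q.
  apply: mulr_gt0; first by rewrite divr_gt0.
  apply: mulr_gt0 => //; apply: divr_gt0; last exact: exprn_gt0.
  by apply: mulr_gt0 => //; exact: exprn_gt0.
have q4 : q <= 1 / 4.
  have : q <= 2 / 3 * (3 / 8) by rewrite ler_pM2l.
  by lra.
have -> : 1 + 8 / 3 * delta * ratio = 1 + 4 * q by rewrite /q; field.
set r0 := lead * _ / _.
have r00 : 0 < r0.
  apply: divr_gt0; last by rewrite addr_gt0.
  by apply: mulr_gt0 => //; rewrite addr_gt0// mulr_gt0.
have a0 : 0 < r0 * t by rewrite mulr_gt0.
suff h : 1 - expZ F (r0 * t) <= r0.
  rewrite leNgt; apply/negP => r0r.
  have := ravg_ltP n_gt0 F a0 (mulr_gt0 rho_gt0 t_gt0).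
  rewrite (root_ravg n_gt0 t_gt0 rho_gt0 rhoE) ltr_pM2r// r0r.
  move: h; rewrite oneB_expZ_ravg// -mulrA -ler_pdivlMl// mulVf ?gt_eqF//.
  by rewrite mulrC -ler_pdivlMr// div1r => /le_gtF ->.
apply: le_trans (oneB_expZ_le n_gt0 F (ltW a0)) _; rewrite -/s2 -/s3 -/s4.
(* The cubic bound reduces to [(1 + 4 * q) - q * (1 + 4 * q)^2 >= 1], which is
   where [q <= 1 / 4] is needed. *)
have rt : r0 * t = 2 * delta * s2 ^+ 2 / s3 * (1 + 4 * q).
  rewrite /r0 /lead tE; field.
  by rewrite y1_neq0 s2_neq0 s3_neq0.
rewrite -subr_ge0.
have -> : r0 - (r0 * t * s2 - (r0 * t) ^+ 2 * s3 / 2 + (r0 * t) ^+ 3 * s4 / 6) =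
  r0 * (1 - t * s2 + t * ((r0 * t) * s3 / 2 - (r0 * t) ^+ 2 * s4 / 6)) by field.
rewrite mulr_ge0 ?(ltW r00)// rt.
have -> : 2 * delta * s2 ^+ 2 / s3 * (1 + 4 * q) * s3 / 2
    - (2 * delta * s2 ^+ 2 / s3 * (1 + 4 * q)) ^+ 2 * s4 / 6
  = delta * s2 ^+ 2 * ((1 + 4 * q) - q * (1 + 4 * q) ^+ 2).
  by rewrite {4}/q /ratio; field.
have h1 : 1 <= (1 + 4 * q) - q * (1 + 4 * q) ^+ 2.
  rewrite -subr_ge0.
  have -> : 1 + 4 * q - q * (1 + 4 * q) ^+ 2 - 1 = q * ((1 - 4 * q) * (3 + 4 * q)) by ring.
  by apply: mulr_ge0; [exact: ltW|apply: mulr_ge0; lra].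
have -> : 1 - t * s2 = - y by rewrite tE mulfVK//; ring.
have -> : t * (delta * s2 ^+ 2 * ((1 + 4 * q) - q * (1 + 4 * q) ^+ 2)) =
  y * (1 + y) * ((1 + 4 * q) - q * (1 + 4 * q) ^+ 2).
  by rewrite tE /y; field.
suff fin (u Q : R) : 0 < u -> 1 <= Q -> 0 <= - u + u * (1 + u) * Q by exact: fin.
move=> u0 Q1; have : 0 <= u * (1 + u) * (Q - 1).
  by apply: mulr_ge0; [apply: mulr_ge0; lra|lra].
by have := sqr_ge0 u; lra.
Qed.

End SurvivalBounds.

(** * Drift and variation of [expZ] under one new edge *)

Section OneStep.
Variables (R : realType) (n : nat).
Hypothesis n_gt0 : (0 < n)%N.
Implicit Types (G : graph n) (k h tau : R).

Let n_ge0 : 0 <= (n%:R : R)^-1. Proof. by rewrite invr_ge0. Qed.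
Let n_neq0 : (n%:R : R) != 0. Proof. by rewrite pnatr_eq0 -lt0n. Qed.

(** [mom1] and [mom2] are minus the first and plus the second derivative of [expZ G] at [k]; for
    [k > 0] both are bounded in terms of [k] alone. *)
Definition mom1 k G : R :=
  n%:R^-1 * \sum_v ((csize G v)%:R * expR (- (k * (csize G v)%:R))).
Definition mom2 k G : R :=
  n%:R^-1 * \sum_v ((csize G v)%:R ^+ 2 * expR (- (k * (csize G v)%:R))).

Lemma mul_expRN_le k (c : R) : 0 < k -> 0 <= c -> c * expR (- (k * c)) <= k^-1.
Proof.
move=> k0 c0; rewrite -[leRHS]mul1r ler_pdivlMr// mulrC mulrA.
by apply: mul_expRN_le1; rewrite mulr_ge0// ltW.
Qed.

Lemma mom1_ge0 k G : 0 <= mom1 k G.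
Proof. by rewrite mulr_ge0//; apply: sumr_ge0 => v _; rewrite mulr_ge0// expR_ge0. Qed.

Lemma mom1_le k G : 0 < k -> mom1 k G <= k^-1.
Proof.
move=> k0; rewrite -[leRHS](avg_cst n_gt0); apply: ler_avg => // v.
exact: mul_expRN_le.
Qed.

Lemma mom2_le k G : 0 < k -> mom2 k G <= 2 * k^-1 ^+ 2.
Proof.
move=> k0; rewrite -[leRHS](avg_cst n_gt0); apply: ler_avg => // v.
rewrite exprVn ler_pdivlMr ?exprn_gt0// mulrAC -exprMn mulrC [_ * k]mulrC mulrC.
by apply: sqr_mul_expRN_le2; rewrite mulr_ge0// ltW.
Qed.

Lemma expZ_diff k tau G : 0 <= tau ->
  [/\ expZ G (k + tau) <= expZ G k,
      expZ G k - expZ G (k + tau) <= tau * mom1 k G &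
      tau * mom1 k G - tau ^+ 2 * mom2 k G / 2 <= expZ G k - expZ G (k + tau)].
Proof.
move=> tau0.
have split_exp (c : R) : expR (- (k * c)) - expR (- ((k + tau) * c)) =
    expR (- (k * c)) * (1 - expR (- (tau * c))).
  by rewrite mulrDl opprD expRD mulrBr mulr1.
have dE : expZ G k - expZ G (k + tau) = n%:R^-1 * \sum_v
    (expR (- (k * (csize G v)%:R)) * (1 - expR (- (tau * (csize G v)%:R)))).
  by rewrite /expZ -mulrBr -sumrB; congr (_ * _); apply: eq_bigr => v _; rewrite split_exp.
have m1 : tau * mom1 k G = n%:R^-1 * \sum_v
    (expR (- (k * (csize G v)%:R)) * (tau * (csize G v)%:R)).
  rewrite /mom1 mulrCA big_distrr/=; congr (_ * _).
  by apply: eq_bigr => v _; ring.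
have m2 : tau ^+ 2 * mom2 k G / 2 = n%:R^-1 * \sum_v
    (expR (- (k * (csize G v)%:R)) * ((tau * (csize G v)%:R) ^+ 2 / 2)).
  rewrite /mom2 [X in _ = _ * X](_ : _ = tau ^+ 2 / 2 *
    \sum_v ((csize G v)%:R ^+ 2 * expR (- (k * (csize G v)%:R)))); first by field.
  by rewrite big_distrr/=; apply: eq_bigr => v _; field.
split; first 2 last.
- rewrite m1 m2 dE -mulrBr -sumrB; apply: ler_avg => // v.
  rewrite -mulrBr ler_wpM2l ?expR_ge0//.
  by have := @expRN_le2 R (tau * (csize G v)%:R) (mulr_ge0 tau0 (ler0n _ _)); lra.
- rewrite -subr_ge0 dE mulr_ge0//; apply: sumr_ge0 => v _.
  by rewrite mulr_ge0 ?expR_ge0// oneB_expRN_ge0// mulr_ge0.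
- rewrite m1 dE; apply: ler_avg => // v.
  by rewrite ler_wpM2l ?expR_ge0//; exact: oneB_expRN_le.
Qed.

Lemma jump_exp k (p q : nat) :
  jump (fun c => expR (- (k * c%:R))) p q =
  - (p%:R * expR (- (k * p%:R)) * (1 - expR (- (k * q%:R)))
     + q%:R * expR (- (k * q%:R)) * (1 - expR (- (k * p%:R)))).
Proof. by rewrite /jump natrD mulrDr opprD expRD; ring. Qed.

Lemma sum_connect (f : nat -> nat -> R) G :
  \sum_a \sum_(b | connect (adj G) a b) f (csize G a) (csize G b) =
  \sum_a (csize G a)%:R * f (csize G a) (csize G a).
Proof.
apply: eq_bigr => a _; rewrite -(vsum_comp (f (csize G a))).
by apply: eq_bigl => b; rewrite inE.
Qed.

Lemma edge_gen_scale (a c : R) (f : graph n -> R) G :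
  edge_gen (fun H => a * f H + c) G = a * edge_gen f G.
Proof. by rewrite /edge_gen big_distrr/=; apply: eq_bigr => e _; ring. Qed.

(** Over all ordered pairs of vertices the jump sums to a product of two averages. The pairs inside
    one component, which an edge does not affect, have to be put back; they form the diagonal sum
    [err], negligible against the main term of order [n]. *)
Lemma edge_gen_expZ k G : 0 < k ->
  exists2 err, 0 <= err <= mom2 k G &
  edge_gen (fun H => expZ H k) G = - (n%:R * mom1 k G * (1 - expZ G k)) + err.
Proof.
move=> k0; pose psi c : R := expR (- (k * c%:R)).
pose w v : R := (csize G v)%:R * psi (csize G v).
exists (n%:R^-1 * \sum_v ((csize G v)%:R * (w v * (1 - psi (csize G v))))).
  have psi1 c : 0 <= 1 - psi c by rewrite oneB_expRN_ge0// mulr_ge0// ltW.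
  apply/andP; split.
    rewrite mulr_ge0//; apply: sumr_ge0 => v _.
    by rewrite !mulr_ge0// expR_ge0.
  apply: ler_avg => // v; rewrite expr2 -mulrA ler_wpM2l//.
  rewrite -[leRHS]mulr1 ler_wpM2l ?mulr_ge0 ?expR_ge0//.
  by rewrite lerBlDr lerDl expR_ge0.
have -> : edge_gen (fun H => expZ H k) G = n%:R^-1 * edge_gen (vsum psi) G.
  by rewrite -(edge_gen_scale _ 0); apply: eq_bigr => e _; rewrite !addr0.
rewrite edge_gen_vsum.
have all_pairs : \sum_a \sum_b jump psi (csize G a) (csize G b) =
   \sum_a \sum_(b | connect (adj G) a b) jump psi (csize G a) (csize G b) +
   \sum_a \sum_(b | ~~ connect (adj G) a b) jump psi (csize G a) (csize G b).
  by rewrite -big_split/=; apply: eq_bigr => a _; exact: bigID.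
have tot : \sum_a \sum_b jump psi (csize G a) (csize G b) =
    - (2 * (n%:R * mom1 k G) * (n%:R * (1 - expZ G k))).
  rewrite oneB_expZ// /mom1 !mulVKf//.
  transitivity (- ((\sum_a \sum_b w a * (1 - psi (csize G b)))
                  + \sum_a \sum_b w b * (1 - psi (csize G a)))).
    rewrite -big_split -sumrN/=; apply: eq_bigr => a _.
    by rewrite -big_split -sumrN/=; apply: eq_bigr => b _; rewrite jump_exp.
  rewrite [X in _ + X]exchange_big/= -big_distrlr/= -mulrA mulr_natl.
  by rewrite mulr2n.
have -> : \sum_a \sum_(b | ~~ connect (adj G) a b) jump psi (csize G a) (csize G b) =
  - (2 * (n%:R * mom1 k G) * (n%:R * (1 - expZ G k)))
  + 2 * \sum_v ((csize G v)%:R * (w v * (1 - psi (csize G v)))).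
  rewrite -tot all_pairs sum_connect big_distrr/= addrAC -big_split/=.
  rewrite [X in _ = X + _]big1 ?add0r// => v _; rewrite jump_exp /w /psi; ring.
by field.
Qed.

(** Since [c exp (- k c) <= 1 / k], a merge changes [n * expZ] by at most [2 / k] whatever the
    component sizes. The squared increments over [O(n)] steps then add up to [O(1 / n)]. *)
Lemma expZ_edge_diff k G (e : {set 'I_n}) : 0 < k -> e \in pairs n ->
  (expZ (e |: G) k - expZ G k) ^+ 2 <= 4 * k^-1 ^+ 2 * n%:R^-1 ^+ 2.
Proof.
move=> k0; rewrite in_pairs => /cards2P[a [b [ab ->]]].
rewrite !expZ_vsum -mulrBr exprMn [leRHS]mulrC ler_wpM2l ?exprn_ge0//.
have [cab|ncab] := boolP (connect (adj G) a b).
  by rewrite vsum_connect// subrr expr0n/= mulr_ge0// sqr_ge0.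
rewrite vsum_merge// addrC addKr jump_exp sqrrN.
have -> : 4 * k^-1 ^+ 2 = (k^-1 + k^-1) ^+ 2 by ring.
have bd (p q : nat) : 0 <= p%:R * expR (- (k * p%:R)) * (1 - expR (- (k * q%:R))) <= k^-1.
  have q0 : 0 <= 1 - expR (- (k * q%:R)) by rewrite oneB_expRN_ge0// mulr_ge0// ltW.
  apply/andP; split; first by rewrite !mulr_ge0// expR_ge0.
  have q1 : 1 - expR (- (k * q%:R)) <= 1 by rewrite gerBl expR_ge0.
  apply: le_trans (mul_expRN_le k0 (ler0n R p)).
  by rewrite ler_piMr// mulr_ge0// expR_ge0.
have /andP[a1 a2] := bd (csize G a) (csize G b).
have /andP[b1 b2] := bd (csize G b) (csize G a).
by rewrite lerXn2r ?nnegrE ?addr_ge0 ?invr_ge0 ?(ltW k0)//; exact: lerD.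
Qed.

Lemma card_pairsE : (#|pairs n|%:R : R) = n%:R * (n%:R - 1) / 2.
Proof.
apply: (@mulfI _ 2); first by rewrite pnatr_eq0.
rewrite mulrCA divff ?pnatr_eq0// mulr1 card_pairs -natrM -mul_bin_diag bin1.
by rewrite natrM -subn1 natrB.
Qed.

Lemma card_pairs_le : (#|pairs n|%:R : R) <= n%:R ^+ 2 / 2.
Proof. by rewrite card_pairsE ler_pM2r// expr2 ler_wpM2l// gerBl. Qed.

(** The carré du champ identity: second moments are governed by the drift of [f] and its squared
    increments. *)
Lemma edge_gen_sqr (f : graph n -> R) G :
  edge_gen (fun H => f H ^+ 2) G =
  2 * f G * edge_gen f G + \sum_(e in pairs n) (f (e |: G) - f G) ^+ 2.
Proof.
by rewrite /edge_gen big_distrr/= -big_split/=; apply: eq_bigr => e _; ring.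
Qed.

End OneStep.

(** * Expectations, edge-adding chains and the one-step inequality *)

Section Chain.
Variable R : realType.

(** A law is represented by its normalised, monotone, linear functional, so the finite sums defining
    the three models can be used directly, without a probability space. *)
Definition expectation (T : Type) (E : (T -> R) -> R) : Prop :=
  [/\ E (fun=> 1) = 1,
      forall f g : T -> R, (forall G, f G <= g G) -> E f <= E g &
      forall (a : R) (f g : T -> R),
        E (fun G => a * f G + g G) = a * E f + E g].

Section Expectation.
Variables (T : Type) (E : (T -> R) -> R).
Hypothesis expE : expectation E.
Implicit Types f g : T -> R.

Lemma expect1 : E (fun=> 1) = 1. Proof. by case: expE. Qed.

Lemma expect_le f g : (forall G, f G <= g G) -> E f <= E g.
Proof. by case: expE => _ h _; exact: h. Qed.

Lemma expect_lin (a : R) f g : E (fun G => a * f G + g G) = a * E f + E g.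
Proof. by case: expE => _ _ h; exact: h. Qed.

Lemma expect_ext f g : f =1 g -> E f = E g.
Proof. by move=> fg; apply/eqP; rewrite eq_le !expect_le// => G; rewrite fg. Qed.

Lemma expect0 : E (fun=> 0) = 0.
Proof.
have := expect_lin (- 1) (fun=> 0) (fun=> 0).
by rewrite !mulN1r !addNr.
Qed.

Lemma expectZ (a : R) f : E (fun G => a * f G) = a * E f.
Proof.
rewrite (@expect_ext _ (fun G => a * f G + 0)); last by move=> G; rewrite addr0.
by rewrite (expect_lin _ _ (fun=> 0)) expect0 addr0.
Qed.

Lemma expectD f g : E (fun G => f G + g G) = E f + E g.
Proof.
rewrite (@expect_ext _ (fun G => 1 * f G + g G)); last by move=> G; rewrite mul1r.
by rewrite expect_lin mul1r.
Qed.

Lemma expect_cst (c : R) : E (fun=> c) = c.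
Proof.
rewrite (@expect_ext _ (fun=> c * 1)); last by move=> G; rewrite mulr1.
by rewrite (expectZ c (fun=> 1)) expect1 mulr1.
Qed.

Lemma expect_ge0 f : (forall G, 0 <= f G) -> 0 <= E f.
Proof. by move=> f0; rewrite -expect0; exact: expect_le. Qed.

Lemma expect_chebyshev f (P : pred T) (e b : R) : 0 < e ->
  (forall G, P G -> e <= `|f G|) -> E (fun G => f G ^+ 2) <= b ->
  E (fun G => (P G : nat)%:R) <= b / e ^+ 2.
Proof.
move=> e0 Pf Eb; rewrite ler_pdivlMr ?exprn_gt0// mulrC -expectZ.
apply: le_trans Eb; apply: expect_le => G.
have [/Pf h|_] := boolP (P G); last by rewrite mulr0 sqr_ge0.
by rewrite mulr1 -[leRHS]real_normK ?num_real// lerXn2r ?nnegrE// ltW.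
Qed.

End Expectation.

(* Random graphs [E 0, E 1, ...] started at [F] in which each step adds an edge
   chosen uniformly from a set containing every absent pair. Pairs that are
   already present do not contribute to [edge_gen f], so only the normalisation
   [c], close to [2 / n ^ 2], depends on the model. *)
Definition edge_chain (n : nat) (F : graph n) (M : nat) (C : R)
    (E : nat -> (graph n -> R) -> R) : Prop :=
  [/\ forall j, (j <= M)%N -> expectation (E j),
      forall f, E 0%N f = f F &
      forall j, (j < M)%N -> exists c : R,
        [/\ 2 * n%:R^-1 ^+ 2 <= c, c <= 2 * n%:R^-1 ^+ 2 + C * n%:R^-1 ^+ 3 &
            forall f, E j.+1 f = E j f + c * E j (edge_gen f)]].

(** Error terms with [H = 1 / h]: [8 H ^ 2] is the Taylor remainder in [h], [32 H ^ 3] the cost of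
    replacing [V ^ 2] by [D ^ 2] in the drift, [2 C H] the error in the rate, and [6 (2 + C) H ^ 2]
    combines pairs inside components (4) with squared increments (2). *)
Definition drift_const (C H : R) : R :=
  8 * H ^+ 2 + 32 * H ^+ 3 + 2 * C * H + 6 * (2 + C) * H ^+ 2.

(* [m] stands for [1 / n], [D] and [V] for the deviation of the size generating
   function before and after [h] moves by [tau = 2 x / n]: the drift caused by
   the new edge cancels the one caused by moving [h], to first order in [m]. *)
Lemma one_step_algebra (C H m N V D W Q x tau c c' Lf S e1 e2 : R) :
  0 <= C -> 0 <= H -> 0 < m -> m <= 1 -> N * m = 1 ->
  `|V| <= 1 -> `|x - V| <= 1 -> 0 <= x -> x <= 1 -> tau = 2 * x * m ->
  0 <= W -> W <= H -> Q <= 2 * H ^+ 2 ->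
  D = V - tau * W + e2 -> 0 <= e2 -> e2 <= tau ^+ 2 * Q / 2 -> D <= V ->
  Lf = - (N * W * (x - V)) + e1 -> 0 <= e1 -> e1 <= Q ->
  0 <= S -> S <= 2 * H ^+ 2 ->
  c = 2 * m ^+ 2 + c' -> 0 <= c' -> c' <= C * m ^+ 3 ->
  V ^+ 2 + c * (2 * V * Lf + S) <=
    (1 + 8 * H * m) * D ^+ 2 + drift_const C H * m ^+ 2.
Proof.
move=> C0 H0 m0 m1 Nm V1 xV1 x0 x1 tauE W0 WH Q2 DE e20 e2Q DV LfE e10 e1Q S0 S2.
move=> cE c'0 c'C.
have m20 : 0 <= m ^+ 2 by exact: sqr_ge0.
have H20 : 0 <= H ^+ 2 by exact: sqr_ge0.
have Q0 : 0 <= Q by exact: le_trans e10 e1Q.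
have N0 : 0 < N by rewrite -(pmulr_lgt0 _ m0) Nm.
have cle : c <= (2 + C) * m ^+ 2.
  rewrite cE [leRHS]mulrDl lerD2l (le_trans c'C)// ler_wpM2l//.
  by rewrite exprSr ler_piMr.
have c0 : 0 <= c by rewrite cE; apply: addr_ge0 => //; exact: mulr_ge0.
have V20 : 0 <= 2 * `|V| by exact: mulr_ge0.
have V2 : 2 * `|V| <= 2 * 1 by rewrite ler_pM2l.
have c'N : c' * N <= C * m ^+ 2.
  have := ler_wpM2r (ltW N0) c'C.
  by rewrite exprSr -!mulrA [m * N]mulrC Nm mulr1.
have A3 : - (2 * V * (c' * N) * W * (x - V)) <= 2 * C * H * m ^+ 2.
  apply: le_trans (ler_norm _) _; rewrite normrN !normrM.
  rewrite (ger0_norm W0) (ger0_norm c'0) (gtr0_norm N0) ger0_norm//.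
  have -> : 2 * C * H * m ^+ 2 = 2 * 1 * (C * m ^+ 2) * H * 1 by ring.
  have c'N0 : 0 <= c' * N by rewrite mulr_ge0// ltW.
  apply: ler_pM => //; first by apply: mulr_ge0 => //; exact: mulr_ge0.
  apply: ler_pM => //; first exact: mulr_ge0.
  exact: ler_pM.
have A4 : 2 * V * c * e1 <= 4 * (2 + C) * H ^+ 2 * m ^+ 2.
  have -> : 4 * (2 + C) * H ^+ 2 * m ^+ 2 = 2 * 1 * ((2 + C) * m ^+ 2) * (2 * H ^+ 2).
    by ring.
  apply: le_trans (ler_norm _) _; rewrite !normrM.
  rewrite (ger0_norm c0) (ger0_norm e10) ger0_norm//.
  apply: ler_pM => //; [exact: mulr_ge0| |exact: le_trans e1Q Q2].
  exact: ler_pM.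
have A5 : c * S <= 2 * (2 + C) * H ^+ 2 * m ^+ 2.
  have -> : 2 * (2 + C) * H ^+ 2 * m ^+ 2 = ((2 + C) * m ^+ 2) * (2 * H ^+ 2) by ring.
  exact: ler_pM.
have tau0 : 0 <= tau.
  by rewrite tauE; apply: mulr_ge0; [exact: mulr_ge0|exact: ltW].
have m2H : 0 <= 2 * m by rewrite mulr_ge0// ltW.
have taum : tau <= 2 * m.
  by rewrite tauE -mulrA ler_pM2l// ler_piMl// ltW.
have e2b : 2 * e2 <= 8 * H ^+ 2 * m ^+ 2.
  have : tau ^+ 2 * Q <= (2 * m) ^+ 2 * (2 * H ^+ 2).
    by apply: ler_pM => //; [exact: sqr_ge0|rewrite lerXn2r ?nnegrE].
  have -> : (2 * m) ^+ 2 * (2 * H ^+ 2) = 8 * H ^+ 2 * m ^+ 2 by ring.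
  by lra.
have A6 : V ^+ 2 - 2 * (tau * V * W) - 2 * e2 <= D ^+ 2.
  have Ve2 : - e2 <= V * e2.
    by rewrite -mulN1r ler_wpM2r//; move: V1; rewrite ler_norml => /andP[].
  have := sqr_ge0 (e2 - tau * W).
  have -> : D ^+ 2 = V ^+ 2 + (e2 - tau * W) ^+ 2 - 2 * (tau * V * W) + 2 * (V * e2).
    by rewrite DE; ring.
  by move: Ve2; lra.
have A7 : V ^+ 2 <= 2 * D ^+ 2 + 8 * H ^+ 2 * m ^+ 2.
  have VD : (V - D) ^+ 2 <= (2 * m * H) ^+ 2.
    rewrite lerXn2r ?nnegrE ?subr_ge0//; first exact: mulr_ge0.
    have : tau * W <= 2 * m * H by exact: ler_pM.
    by rewrite DE; lra.
  have := sqr_ge0 (V - 2 * D).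
  have -> : (V - 2 * D) ^+ 2 = 2 * (V - D) ^+ 2 + 2 * D ^+ 2 - V ^+ 2 by ring.
  by move: VD; rewrite !exprMn; lra.
have A8 : 4 * m * W * V ^+ 2 <= 8 * H * m * D ^+ 2 + 32 * H ^+ 3 * m ^+ 2.
  have s1 : 4 * m * W * V ^+ 2 <= 4 * m * H * (2 * D ^+ 2 + 8 * H ^+ 2 * m ^+ 2).
    apply: ler_pM => //; [|exact: sqr_ge0|].
      by apply: mulr_ge0 => //; rewrite mulr_ge0// ltW.
    by rewrite ler_wpM2l// mulr_ge0// ltW.
  have s2 : 32 * H ^+ 3 * m ^+ 2 * m <= 32 * H ^+ 3 * m ^+ 2.
    rewrite ler_piMr//; apply: mulr_ge0 => //; apply: mulr_ge0 => //.
    exact: exprn_ge0.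
  apply: le_trans s1 _.
  have -> : 4 * m * H * (2 * D ^+ 2 + 8 * H ^+ 2 * m ^+ 2) =
    8 * H * m * D ^+ 2 + 32 * H ^+ 3 * m ^+ 2 * m by ring.
  by rewrite lerD2l.
(* [A6] absorbs the term [- 2 tau V W] by passing from [V] to [D]. The rest of the main drift is
   [4 m W V ^ 2], quadratic in the deviation, and produces the factor [1 + 8 H m] through [A8]. *)
have -> : c * (2 * V * Lf + S) = - (2 * (tau * V * W)) + 4 * m * W * V ^+ 2
    - (2 * V * (c' * N) * W * (x - V)) + 2 * V * c * e1 + c * S.
  have mN2 : m ^+ 2 * N = m by rewrite expr2 -mulrA [m * N]mulrC Nm mulr1.
  have cN : c * N = 2 * m + c' * N by rewrite cE mulrDl -mulrA mN2.
  have -> : c * (2 * V * Lf + S) =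
    - (2 * V * (c * N) * W * (x - V)) + 2 * V * c * e1 + c * S by rewrite LfE; ring.
  by rewrite cN tauE; ring.
rewrite /drift_const.
clear - A3 A4 A5 A6 A8 e2b.
by lra.
Qed.

End Chain.

(** * Concentration of [expZ] along the characteristics *)

Section Concentration.
Variable R : realType.

Lemma expZ_lt1 (n : nat) (F : graph n) (a : R) : (0 < n)%N -> 0 < a -> expZ F a < 1.
Proof.
move=> n0 a0; apply: (@le_lt_trans _ _ (expR (- a))); last by rewrite expR_lt1 oppr_lt0.
rewrite -[leRHS](avg_cst n0); apply: ler_avg => // v.
by rewrite ler_expR lerN2 ler_peMr ?(ltW a0)// ler1n csize_gt0.
Qed.

Lemma edge_chain_step (n : nat) (F : graph n) (M : nat) (C h0 k x : R)
    (E : nat -> (graph n -> R) -> R) (j : nat) :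
  (0 < n)%N -> 0 <= C -> edge_chain F M C E -> (j < M)%N ->
  0 < h0 -> h0 <= k -> 0 <= x -> x <= 1 ->
  E j.+1 (fun G => (expZ G k - (1 - x)) ^+ 2) <=
    (1 + 8 * h0^-1 * n%:R^-1) *
      E j (fun G => (expZ G (k + 2 * x * n%:R^-1) - (1 - x)) ^+ 2)
    + drift_const C h0^-1 * n%:R^-1 ^+ 2.
Proof.
move=> n0 C0 [expE _ step] jM h00 h0k x0 x1.
have [c [c1 c2 ->]] := step j jM; have Ej := expE j (ltnW jM).
have k0 : 0 < k by exact: lt_le_trans h0k.
have nR0 : 0 < n%:R :> R by rewrite ltr0n.
have nR1 : 1 <= n%:R :> R by rewrite ler1n.
set m : R := n%:R^-1; set tau := 2 * x * m.
have m0 : 0 < m by rewrite invr_gt0.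
have m1 : m <= 1 by rewrite invf_le1.
have Nm : n%:R * m = 1 by rewrite divff// gt_eqF.
have tau0 : 0 <= tau by rewrite !mulr_ge0// ltW.
have kH : k^-1 <= h0^-1 by rewrite lef_pV2.
have k2H : k^-1 ^+ 2 <= h0^-1 ^+ 2.
  by rewrite lerXn2r ?nnegrE ?invr_ge0// ltW.
rewrite addrC -(expect_lin Ej) -(expectZ Ej).
rewrite -(expect_cst Ej (drift_const C h0^-1 * m ^+ 2)) -(expectD Ej).
apply: (expect_le Ej) => G; rewrite addrC edge_gen_sqr.
have [err /andP[err0 err1] errE] := edge_gen_expZ n0 G k0.
have -> : edge_gen (fun H => expZ H k - (1 - x)) G = edge_gen (fun H => expZ H k) G.
  by apply: eq_bigr => e _; ring.
have [d1 d2 d3] := expZ_diff n0 k G tau0.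
have z0 := expZ_gt0 n0 G k; have z1 := expZ_le1 n0 G (ltW k0).
set V := expZ G k - (1 - x).
have V1 : `|V| <= 1 by rewrite ler_norml /V; apply/andP; split; lra.
have xV : x - V = 1 - expZ G k by rewrite /V; ring.
have xV1 : `|x - V| <= 1 by rewrite xV ler_norml; apply/andP; split; lra.
(* Here [c'] is the excess of the rate over [2 / n ^ 2], [e1] the contribution of pairs inside a
   component, and [e2] the Taylor remainder of moving [k] by [tau]. *)
apply: (@one_step_algebra R C h0^-1 m n%:R V _ (mom1 k G) (mom2 k G) x tau c
  (c - 2 * m ^+ 2) _ _ err (expZ G (k + tau) - (1 - x) - V + tau * mom1 k G)) => //.
- by rewrite invr_ge0 ltW.
- exact: mom1_ge0.
- exact: le_trans (mom1_le n0 G k0) kH.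
- by apply: le_trans (mom2_le n0 G k0) _; rewrite ler_pM2l.
- by rewrite /V; ring.
- by rewrite /V; lra.
- by rewrite /V; lra.
- by rewrite /V; lra.
- by rewrite xV -mulrA mulrA.
- by apply: sumr_ge0 => e _; exact: sqr_ge0.
- have : \sum_(e in pairs n) (expZ (e |: G) k - (1 - x) - V) ^+ 2 <=
      \sum_(e in pairs n) (4 * k^-1 ^+ 2 * m ^+ 2).
    apply: ler_sum => e eP; have := expZ_edge_diff G k0 eP.
    by have -> : expZ (e |: G) k - (1 - x) - V = expZ (e |: G) k - expZ G k
      by rewrite /V; ring.
  move=> /le_trans; apply; rewrite sumr_const -[leLHS]mulr_natl.
  apply: (@le_trans _ _ (n%:R ^+ 2 / 2 * (4 * k^-1 ^+ 2 * m ^+ 2))).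
    apply: ler_wpM2r; last exact: card_pairs_le.
    by apply: mulr_ge0; [apply: mulr_ge0 => //|]; exact: sqr_ge0.
  have -> : n%:R ^+ 2 / 2 * (4 * k^-1 ^+ 2 * m ^+ 2) = 2 * k^-1 ^+ 2 * (n%:R * m) ^+ 2.
    by field; rewrite ?gt_eqF.
  by rewrite Nm expr1n mulr1 ler_pM2l.
- by ring.
- by rewrite subr_ge0.
- by rewrite lerBlDl.
Qed.

Lemma expZ_fixed_point (n : nat) (F : graph n) (h s : R) :
  (0 < n)%N -> 0 < h -> 0 <= s ->
  exists x, [/\ 0 < x, x <= 1 & x = 1 - expZ F (h + s * x)].
Proof.
move=> n0 h0 s0; pose g y : R := y - (1 - expZ F (h + s * y)).
have cg : {within `[0, 1]%classic, continuous g}%classic.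
  apply: continuous_subspaceT => r; rewrite /g.
  apply: cvgB; first exact: cvg_id.
  apply: cvgB; first exact: cvg_cst.
  apply: continuous_cvg; first exact: continuous_expZ.
  apply: cvgD; first exact: cvg_cst.
  by apply: cvgM; [exact: cvg_cst|exact: cvg_id].
have g0 : g 0 <= 0.
  by rewrite /g mulr0 addr0; have := expZ_lt1 F n0 h0; lra.
have g1 : 0 <= g 1 by rewrite /g; have := expZ_gt0 n0 F (h + s * 1); lra.
have [|x] := @IVT R g 0 1 0 ler01 cg.
  by rewrite ge_min g0 /= le_max g1 orbT.
rewrite in_itv/= => /andP[x0 x1] gx.
have ex : x = 1 - expZ F (h + s * x) by move: gx; rewrite /g; lra.
exists x; split => //; rewrite ex subr_gt0; apply: expZ_lt1 => //.
by rewrite ltr_wpDr// mulr_ge0.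
Qed.

(* Along [h_i = h + 2 (j - i) x / n] the quantity [1 - expZ G h_i] is nearly a
   martingale, started exactly at [x]: these are the characteristics of the
   Burgers equation satisfied by the size generating function. *)
Lemma expZ_concentration (C T h : R) : 0 <= C -> 0 <= T -> 0 < h ->
  exists2 B, 0 <= B & forall (n : nat) (F : graph n) (M : nat)
      (E : nat -> (graph n -> R) -> R) (j : nat),
    (0 < n)%N -> edge_chain F M C E -> (j <= M)%N -> j%:R <= T * n%:R ->
    exists x, [/\ 0 < x, x <= 1, x = 1 - expZ F (h + 2 * j%:R / n%:R * x) &
      E j (fun G => (expZ G h - (1 - x)) ^+ 2) <= B / n%:R].
Proof.
move=> C0 T0 h0; have H0 : 0 <= h^-1 by rewrite invr_ge0 ltW.
have B0 : 0 <= drift_const C h^-1.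
  rewrite /drift_const; have := exprn_ge0 2 H0; have := exprn_ge0 3 H0 => p3 p2.
  by rewrite !addr_ge0// mulr_ge0// mulr_ge0// addr_ge0.
exists (T * drift_const C h^-1 * expR (8 * h^-1 * T)).
  by rewrite !mulr_ge0// expR_ge0.
move=> n F M E j n0 chE jM jT.
have nR0 : 0 < n%:R :> R by rewrite ltr0n.
have m0 : 0 < n%:R^-1 :> R by rewrite invr_gt0.
have s0 : 0 <= 2 * j%:R / n%:R :> R by rewrite !mulr_ge0// ltW.
have [x [x0 x1 ex]] := expZ_fixed_point F n0 h0 s0; exists x; split => //.
set m : R := n%:R^-1 in m0 ex *; set A := 8 * h^-1 * m.
have A0 : 0 <= A by rewrite !mulr_ge0// ltW.
have mB0 : 0 <= drift_const C h^-1 * m ^+ 2 by rewrite mulr_ge0// sqr_ge0.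
pose hh i := h + 2 * (j - i)%:R * m * x.
have main i : (i <= j)%N -> E i (fun G => (expZ G (hh i) - (1 - x)) ^+ 2) <=
    i%:R * (drift_const C h^-1 * m ^+ 2) * (1 + A) ^+ i.
  elim: i => [_|i IH ij].
    case: (chE) => _ -> _; rewrite mul0r mul0r /hh subn0.
    by rewrite {2}ex subKr subrr expr0n.
  have hstep : hh i = hh i.+1 + 2 * x * m.
    by rewrite /hh -[in LHS](subnSK ij) -natr1; ring.
  have hk : h <= hh i.+1 by rewrite /hh lerDl !mulr_ge0// ltW.
  apply: le_trans (edge_chain_step n0 C0 chE (leq_trans ij jM) h0 hk (ltW x0) x1) _.
  rewrite -/m -hstep -/A.
  have A1 : 0 <= 1 + A by rewrite addr_ge0.
  apply: le_trans (lerD (ler_wpM2l A1 (IH (ltnW ij))) (lexx _)) _.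
  set b := drift_const C h^-1 * m ^+ 2.
  rewrite [leRHS](_ : _ = (1 + A) * (i%:R * b * (1 + A) ^+ i) + b * (1 + A) ^+ i.+1).
    by rewrite lerD2l ler_peMr// exprn_ege1// lerDl.
  by rewrite -natr1 exprS; ring.
have := main j (leqnn j).
have -> : hh j = h by rewrite /hh subnn mulr0 !mul0r addr0.
move=> /le_trans; apply.
have pow : (1 + A) ^+ j <= expR (8 * h^-1 * T).
  apply: (@le_trans _ _ (expR A ^+ j)).
    by rewrite lerXn2r ?nnegrE ?expR_ge0 ?addr_ge0//; exact: expR_ge1Dx.
  rewrite -expRM_natl ler_expR /A mulrC -!mulrA ler_pM2l// ler_wpM2l//.
  by rewrite mulrC ler_pdivrMr.
have jm : j%:R * m <= T by rewrite ler_pdivrMr.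
apply: (@le_trans _ _ (j%:R * m * (drift_const C h^-1 * m) * expR (8 * h^-1 * T))).
  have -> : j%:R * (drift_const C h^-1 * m ^+ 2) = j%:R * m * (drift_const C h^-1 * m).
    by ring.
  by rewrite ler_wpM2l// !mulr_ge0// ltW.
rewrite [leRHS](_ : _ = T * (drift_const C h^-1 * m) * expR (8 * h^-1 * T)); last by ring.
by rewrite ler_wpM2r ?expR_ge0// ler_wpM2r// mulr_ge0// ltW.
Qed.
End Concentration.

(** * Comparing the largest component with [expZ] *)

Section LargestComponent.
Variable R : realType.

Lemma eventually_ge (b : R) : exists N : nat, forall n : nat, (N <= n)%N -> b <= n%:R.
Proof.
exists (Num.truncn b).+1 => n Nn; apply: ltW.
by apply: lt_le_trans (truncnS_gt b) _; rewrite ler_nat.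
Qed.

Definition ind (T : Type) (P : pred T) (G : T) : R := (P G : nat)%:R.

Lemma C1_le_expZ (n : nat) (G : graph n) (h : R) : (0 < n)%N -> 0 < h ->
  (C1 G)%:R / n%:R - expR (- (h * (C1 G)%:R)) <= 1 - expZ G h.
Proof.
move=> n0 h0; rewrite oneB_expZ//; have [v Cv] := C1_attained G n0.
have nR0 : 0 < n%:R :> R by rewrite ltr0n.
pose f w : R := 1 - expR (- (h * (csize G w)%:R)).
have f0 w : 0 <= f w by rewrite oneB_expRN_ge0// mulr_ge0// ltW.
have -> : \sum_w (1 - expR (- (h * (csize G w)%:R))) = \sum_w f w by [].
apply: (@le_trans _ _ (n%:R^-1 * ((C1 G)%:R * (1 - expR (- (h * (C1 G)%:R)))))).
  rewrite mulrA [n%:R^-1 * _]mulrC mulrBr mulr1 lerD2l lerN2.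
  rewrite ler_piMl ?expR_ge0// ler_pdivrMr// mul1r ler_nat; exact: C1_le.
rewrite ler_wpM2l ?invr_ge0// Cv -(vsum_comp (fun c => 1 - expR (- (h * c%:R)))).
rewrite [leRHS](bigID (mem (comp G v)))/= lerDl.
by apply: sumr_ge0.
Qed.

Section Merging.
Variables (n : nat) (h : R).
Hypotheses (n_gt0 : (0 < n)%N) (h_gt0 : 0 < h).
Implicit Types G : graph n.

(* Summed over vertices this counts each component [c] with weight
   [1 - exp (- h c)], so that merging two components of size at least about
   [1 / h] lowers the total by about 1. *)
Definition comp_weight (c : nat) : R := (1 - expR (- (h * c%:R))) / c%:R.

Lemma mul_comp_weight (c : nat) :
  c%:R * comp_weight c = 1 - expR (- (h * c%:R)).
Proof.
case: c => [|c]; first by rewrite mul0r mulr0 oppr0 expR0 subrr.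
by rewrite mulrC mulfVK// pnatr_eq0.
Qed.

Lemma vsum_comp_weight_ge0 G : 0 <= vsum comp_weight G.
Proof.
apply: sumr_ge0 => v _; apply: divr_ge0 => //.
by rewrite oneB_expRN_ge0// mulr_ge0// ltW.
Qed.

Lemma vsum_comp_weight_le G : vsum comp_weight G <= h * n%:R.
Proof.
rewrite [leRHS](_ : _ = \sum_(v < n) h); last first.
  by rewrite sumr_const card_ord mulr_natr.
apply: ler_sum => v _; rewrite ler_pdivrMr ?ltr0n ?csize_gt0//.
exact: oneB_expRN_le.
Qed.

(** With [f = 1 - exp (- h c)], merging components of [a] and [b] changes the total by exactly
    [- f a * f b]. All ordered pairs together give minus the square of the sum of [f], and pairs
    inside a component take back at most [C1 G] times that sum. *)
Lemma edge_gen_comp_weight G :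
  edge_gen (vsum comp_weight) G <= 0 /\
  edge_gen (vsum comp_weight) G <=
    - (n%:R ^+ 2 / 2 * (1 - expZ G h) * (1 - expZ G h - (C1 G)%:R / n%:R)).
Proof.
pose f v : R := 1 - expR (- (h * (csize G v)%:R)).
have f0 v : 0 <= f v by rewrite oneB_expRN_ge0// mulr_ge0// ltW.
have f1 v : f v <= 1 by rewrite gerBl expR_ge0.
have nR0 : (n%:R : R) != 0 by rewrite pnatr_eq0 -lt0n.
have jumpE a b : jump comp_weight (csize G a) (csize G b) = - (f a * f b).
  rewrite /jump !mul_comp_weight natrD mulrDr opprD expRD /f; ring.
rewrite edge_gen_vsum.
set S := \sum_a _.
have SE : S = - \sum_a \sum_(b | ~~ connect (adj G) a b) f a * f b.
  rewrite /S -sumrN; apply: eq_bigr => a _; rewrite -sumrN.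
  by apply: eq_bigr => b _; exact: jumpE.
have fS : \sum_v f v = n%:R * (1 - expZ G h) by rewrite oneB_expZ// mulVKf.
have tot : (\sum_v f v) ^+ 2 = \sum_a (csize G a)%:R * (f a * f a)
    + \sum_a \sum_(b | ~~ connect (adj G) a b) f a * f b.
  rewrite expr2 big_distrlr/=.
  rewrite -(sum_connect (fun p q => (1 - expR (- (h * p%:R))) * (1 - expR (- (h * q%:R))))).
  by rewrite -big_split/=; apply: eq_bigr => a _; exact: bigID.
split.
  rewrite SE mulrN oppr_le0 mulr_ge0//; apply: sumr_ge0 => a _.
  by apply: sumr_ge0 => b _; rewrite mulr_ge0.
have diag : \sum_a (csize G a)%:R * (f a * f a) <= (C1 G)%:R * \sum_v f v.
  rewrite big_distrr/=; apply: ler_sum => a _; apply: ler_pM => //.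
  - exact: mulr_ge0.
  - by rewrite ler_nat csize_le_C1.
  - by rewrite ler_piMr.
have -> : n%:R ^+ 2 / 2 * (1 - expZ G h) * (1 - expZ G h - (C1 G)%:R / n%:R) =
    2^-1 * ((n%:R * (1 - expZ G h)) ^+ 2 - (C1 G)%:R * (n%:R * (1 - expZ G h))).
  by field.
by rewrite -fS tot SE -mulrN ler_pM2l//; lra.
Qed.

End Merging.

Lemma edge_chain_le (n : nat) (F : graph n) (M : nat) (C : R)
    (E : nat -> (graph n -> R) -> R) (f : graph n -> R) (i j : nat) :
  edge_chain F M C E -> (forall G e, f (e |: G) <= f G) ->
  (i <= j)%N -> (j <= M)%N -> E j f <= E i f.
Proof.
move=> [expE _ step] fle /subnK <-; elim: (j - i)%N => // k IH kM.
apply: le_trans (IH (ltnW kM)); have [c [c0 _ ->]] := step _ kM.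
rewrite gerDl; apply: mulr_ge0_le0.
  by apply: le_trans c0; rewrite mulr_ge0// exprn_ge0// invr_ge0.
rewrite -(expect0 (expE _ (ltnW kM))); apply: (expect_le (expE _ (ltnW kM))) => G.
by apply: sumr_le0 => e _; rewrite subr_le0.
Qed.

(** One [eps] is spent on Chebyshev around [x], the other on the distance from [x] to [rho].
    Stability is a hypothesis so that [h] may be chosen after [d]. *)
Lemma chain_concentration (C t del eps h d : R) :
  0 <= C -> 0 < t -> 0 < del -> 0 < eps -> 0 < h -> h <= d -> d <= t ->
  (forall (n : nat) (F : graph n) (rho h s x : R),
    (0 < n)%N -> giant_fraction F t rho -> 0 < h -> h <= d -> `|s - t| <= d ->
    0 < x -> x <= 1 -> x = 1 - expZ F (h + s * x) -> `|x - rho| <= eps) ->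
  exists n0 : nat, forall (n : nat) (F : graph n) (M : nat)
      (E : nat -> (graph n -> R) -> R) (j : nat) (rho : R),
    (0 < n)%N -> (n0 <= n)%N -> edge_chain F M C E -> (j <= M)%N ->
    `|2 * j%:R / n%:R - t| <= d -> giant_fraction F t rho ->
    E j (ind (fun G => ~~ (`|1 - expZ G h - rho| < 2 * eps))) <= del.
Proof.
move=> C0 t0 del0 eps0 h0 hd dt fp.
have T0 : 0 <= t by exact: ltW.
have [B B0 conc] := expZ_concentration C0 T0 h0.
have [n0 n0P] := eventually_ge (B / (eps ^+ 2 * del)).
exists n0 => n F M E j rho n_gt0 nn0 chE jM jt gf.
have nR0 : 0 < n%:R :> R by rewrite ltr0n.
have jT : j%:R <= t * n%:R.
  move: jt; rewrite ler_norml => /andP[_ h1].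
  have : 2 * j%:R / n%:R <= 2 * t by lra.
  by rewrite ler_pdivrMr// -mulrA ler_pM2l.
have [x [x0 x1 ex xB]] := conc n F M E j n_gt0 chE jM jT.
have xr := fp n F rho h _ x n_gt0 gf h0 hd jt x0 x1 ex.
have Ej : expectation (E j) by case: chE => H _ _; exact: H.
have cheb := @expect_chebyshev _ _ _ Ej (fun G => expZ G h - (1 - x))
  (fun G => ~~ (`|1 - expZ G h - rho| < 2 * eps)) _ _ eps0 _ xB.
apply: le_trans (cheb _) _.
  move=> G; rewrite -leNgt => big; rewrite distrC.
  have -> : 1 - x - expZ G h = (1 - expZ G h - rho) - (x - rho) by ring.
  apply: le_trans (lerB_dist _ _); lra.
have e2 : 0 < eps ^+ 2 by exact: exprn_gt0.
rewrite ler_pdivrMr// ler_pdivrMr// mulrC.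
have := n0P n nn0; rewrite ler_pdivrMr; last exact: mulr_gt0.
by rewrite [eps ^+ 2 * _]mulrC.
Qed.

End LargestComponent.

Arguments ind {R T}.

(** * Upper and lower bounds on [C1] along a chain *)

Section GiantComponent.
Variable R : realType.

Lemma giant_upper (C t eps del : R) :
  0 <= C -> 0 < t -> 0 < eps -> 0 < del ->
  exists2 eta : R, 0 < eta & exists n0 : nat, forall (n : nat) (F : graph n)
      (M : nat) (E : nat -> (graph n -> R) -> R) (m : nat) (rho : R),
    (0 < n)%N -> (n0 <= n)%N -> edge_chain F M C E -> (m <= M)%N ->
    `|2 * m%:R / n%:R - t| <= eta -> giant_fraction F t rho ->
    E m (ind (fun G => rho + eps < (C1 G)%:R / n%:R)) <= del.
Proof.
move=> C0 t0 eps0 del0; have e4 : 0 < eps / 4 by lra.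
have [d' d'0 fp'] := fixed_point_stable t0 e4.
pose d := Num.min d' t.
have d0 : 0 < d by rewrite /d lt_min d'0.
have dd' : d <= d' by rewrite /d ge_min lexx.
have dt : d <= t by rewrite /d ge_min lexx orbT.
clearbody d.
have fp (n : nat) (F : graph n) (rho h s x : R) : (0 < n)%N ->
    giant_fraction F t rho -> 0 < h -> h <= d -> `|s - t| <= d ->
    0 < x -> x <= 1 -> x = 1 - expZ F (h + s * x) -> `|x - rho| <= eps / 4.
  by move=> n0 gf h0 hd sd; apply: fp' => //; [exact: le_trans dd'|exact: le_trans dd'].
have [n0 conc] := chain_concentration C0 t0 del0 e4 d0 (lexx d) dt fp.
(* For such [n], [C1 >= eps n] forces [exp (- d C1) <= 1 / (d eps n) <= eps / 4]. *)
have [n1 n1P] := eventually_ge ((d * eps * (eps / 4))^-1).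
exists d => //; exists (maxn n0 n1) => n F M E m rho n_gt0.
rewrite geq_max => /andP[nn0 nn1] chE mM mt gf.
have Em : expectation (E m) by case: chE => H _ _; exact: H.
apply: le_trans (conc n F M E m rho n_gt0 nn0 chE mM mt gf).
apply: (expect_le Em) => G; rewrite /ind ler_nat.
case: ltP => // big; case: ltP => //= close.
have nR0 : 0 < n%:R :> R by rewrite ltr0n.
have rho0 := giant_fraction_ge0 gf.
have cn : eps * n%:R <= (C1 G)%:R.
  by rewrite -ler_pdivlMr//; apply: ltW; apply: le_lt_trans big; lra.
have := C1_le_expZ G n_gt0 d0.
have : expR (- (d * (C1 G)%:R)) <= eps / 4.
  rewrite expRN; apply: (@le_trans _ _ (d * eps * n%:R)^-1).
    rewrite lef_pV2 ?posrE ?expR_gt0//; last by rewrite !mulr_gt0.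
    apply: le_trans (expR_ge1Dx _); rewrite -mulrA.
    by apply: (@le_trans _ _ (d * (C1 G)%:R)); [rewrite ler_pM2l|rewrite lerDr].
  have de : 0 < d * eps by exact: mulr_gt0.
  have n1' : 1 <= n%:R * (d * eps * (eps / 4)).
    by rewrite -ler_pdivrMr ?div1r ?n1P//; exact: mulr_gt0.
  rewrite -[leLHS]div1r ler_pdivrMr; last exact: mulr_gt0.
  by move: n1'; lra.
move: close; rewrite ltr_norml => /andP[c1 c2].
by move: big; lra.
Qed.

(** [C1] only grows, so if it is small at step [m] it was small throughout the preceding window of
    [w] steps. If this had probability above [del], each step of the window would lower the expected
    [vsum (comp_weight h)] by [gain], in total more than its initial value, at most [h n],
    allows. *)
Lemma giant_lower (C t eps del : R) :
  0 <= C -> 0 < t -> 0 < eps -> 0 < del ->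
  exists2 eta : R, 0 < eta & exists n0 : nat, forall (n : nat) (F : graph n)
      (M : nat) (E : nat -> (graph n -> R) -> R) (m : nat) (rho : R),
    (0 < n)%N -> (n0 <= n)%N -> edge_chain F M C E -> (m <= M)%N ->
    `|2 * m%:R / n%:R - t| <= eta -> giant_fraction F t rho ->
    E m (ind (fun G => (C1 G)%:R / n%:R < rho - eps)) <= del.
Proof.
move=> C0 t0 eps0 del0; have e4 : 0 < eps / 4 by lra.
have del2 : 0 < del / 2 by lra.
have [d' d'0 fp'] := fixed_point_stable t0 e4.
pose d := Num.min d' t.
have d0 : 0 < d by rewrite /d lt_min d'0.
have dd' : d <= d' by rewrite /d ge_min lexx.
have dt : d <= t by rewrite /d ge_min lexx orbT.
clearbody d.
have fp (n : nat) (F : graph n) (rho h s x : R) : (0 < n)%N ->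
    giant_fraction F t rho -> 0 < h -> h <= d -> `|s - t| <= d ->
    0 < x -> x <= 1 -> x = 1 - expZ F (h + s * x) -> `|x - rho| <= eps / 4.
  by move=> n0 gf h0 hd sd; apply: fp' => //; [exact: le_trans dd'|exact: le_trans dd'].
(* When [1 - expZ G h] is within [eps / 2] of [rho > eps] and [C1 / n < rho - eps], both
   [1 - expZ G h] and its excess over [C1 / n] are at least [eps / 2]. The two conditions hold
   together with probability at least [del - del / 2]. *)
have [gain gainE] : exists g, g = eps ^+ 2 / 4 * (del / 2) by eexists.
have e24 : 0 < eps ^+ 2 / 4 by rewrite divr_gt0// exprn_gt0.
have gain0 : 0 < gain by rewrite gainE mulr_gt0.
(* Then [h n <= d n gain / 16], below the total loss [w gain >= d n gain / 8]. *)
pose h := Num.min d (d * gain / 16).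
have dg : 0 < d * gain by exact: mulr_gt0.
have h0 : 0 < h by rewrite /h lt_min d0; lra.
have hd : h <= d by rewrite /h ge_min lexx.
have hg : h <= d * gain / 16 by rewrite /h ge_min lexx orbT.
clearbody h.
have [n0 conc] := chain_concentration C0 t0 del2 e4 h0 hd dt fp.
have [n1 n1P] := eventually_ge (8 / d).
(* The other half of [d] is left for the window: [w <= d n / 4] steps move [2 i / n] by at most
   [d / 2]. *)
exists (d / 2); first by lra.
exists (maxn n0 n1) => n F M E m rho n_gt0.
rewrite geq_max => /andP[nn0 nn1] chE mM mt gf.
have [expE _ step] := chE.
have nR0 : 0 < n%:R :> R by rewrite ltr0n.
have [re|re] := leP rho eps.
  apply: (@le_trans _ _ 0); last exact: ltW.
  rewrite -(expect0 (expE m mM)); apply: (expect_le (expE m mM)) => G.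
  have c0 : 0 <= (C1 G)%:R / n%:R :> R by exact: divr_ge0.
  by rewrite /ind; case: ltP => // small; lra.
set P := fun G : graph n => (C1 G)%:R / n%:R < rho - eps.
set nc := fun G : graph n => ~~ (`|1 - expZ G h - rho| < 2 * (eps / 4)).
rewrite leNgt; apply/negP => pbig.
have dn0 : 0 < d * n%:R by exact: mulr_gt0.
pose w := Num.truncn (d * n%:R / 4).
have wle : w%:R <= d * n%:R / 4 by rewrite truncn_le; lra.
have wge : d * n%:R / 8 <= w%:R.
  have w1 : d * n%:R / 4 < w%:R + 1 by rewrite natr1 truncnS_gt.
  have n8 : 8 <= n%:R * d by rewrite -ler_pdivrMr ?n1P.
  by clear - w1 n8; move: w%:R w1 => u w1; lra.
clearbody w.
have [mt1 mt2] : (t - d / 2) * n%:R <= 2 * m%:R /\ 2 * m%:R <= (t + d / 2) * n%:R.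
  move: mt; rewrite ler_norml => /andP[h1 h2].
  by split; [rewrite -ler_pdivlMr//|rewrite -ler_pdivrMr//]; lra.
have tn : d * n%:R <= t * n%:R by rewrite ler_pM2r.
have wm : (w <= m)%N by rewrite -(ler_nat R); lra.
have step_gain i : (m - w <= i)%N -> (i < m)%N ->
    E i.+1 (vsum (comp_weight h)) <= E i (vsum (comp_weight h)) - gain.
  move=> wi im; have iM : (i < M)%N by exact: leq_trans mM.
  have Ei := expE i (ltnW iM).
  have it : `|2 * i%:R / n%:R - t| <= d.
    have i1 : m%:R - w%:R <= i%:R :> R by rewrite -natrB// ler_nat.
    have i2 : i%:R <= m%:R :> R by rewrite ler_nat ltnW.
    rewrite ler_norml lerBrDr lerBlDr ler_pdivlMr// ler_pdivrMr//.
    by clear - mt1 mt2 i1 i2 wle tn; apply/andP; split; lra.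
  have qle : E i (ind nc) <= del / 2 by exact: conc chE (ltnW iM) it gf.
  have ple : E m (ind P) <= E i (ind P).
    apply: (edge_chain_le chE _ (ltnW im) mM) => G e; rewrite /ind ler_nat.
    case: (boolP (P (e |: G))) => // Pe; rewrite /P.
    suff -> : (C1 G)%:R / n%:R < rho - eps by [].
    apply: le_lt_trans Pe; rewrite ler_pM2r ?invr_gt0// ler_nat.
    by apply: C1_sub => //; exact: finset.subsetUr.
  have [c [c1 _ ->]] := step i iM.
  have n2 : 0 < n%:R ^+ 2 / 2 :> R by rewrite divr_gt0// exprn_gt0.
  have pw : E i (edge_gen (vsum (comp_weight h))) <=
      - (n%:R ^+ 2 / 2 * (eps ^+ 2 / 4)) * (E i (ind P) - E i (ind nc)).
    rewrite mulrBr -mulNr opprK -!(expectZ Ei) -(expectD Ei).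
    apply: (expect_le Ei) => G.
    have [g1 g2] := edge_gen_comp_weight n_gt0 h0 G.
    have k0 : 0 <= n%:R ^+ 2 / 2 * (eps ^+ 2 / 4) :> R by rewrite mulr_ge0// ltW.
    rewrite /ind; case: (boolP (P G)) => [PG|_] /=; last first.
      apply: le_trans g1 _; rewrite mulr0 add0r.
      by rewrite mulr_ge0.
    case: (boolP (nc G)) => [_|] /=.
      by apply: le_trans g1 _; rewrite !mulr1 addNr.
    rewrite /nc negbK ltr_norml => /andP[cl1 cl2].
    rewrite mulr0 addr0 mulr1; apply: le_trans g2 _.
    rewrite lerN2 -[leRHS]mulrA ler_pM2l//.
    have -> : eps ^+ 2 / 4 = eps / 2 * (eps / 2) by field.
    by move: PG; rewrite /P => PG; clear - re PG cl1 cl2 eps0; apply: ler_pM; lra.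
  rewrite lerD2l.
  have dlt : del / 2 <= E i (ind P) - E i (ind nc).
    by move: pbig ple qle; clear; lra.
  have c0 : 0 <= c.
    by apply: le_trans c1; rewrite mulr_ge0// exprn_ge0// invr_ge0 ltW.
  apply: le_trans (ler_wpM2l c0 pw) _.
  rewrite mulNr mulrN lerN2 gainE.
  rewrite [leRHS](_ : _ = c * (n%:R ^+ 2 / 2) * (eps ^+ 2 / 4) *
    (E i (ind P) - E i (ind nc))); last by rewrite !mulrA.
  have cn : 1 <= c * (n%:R ^+ 2 / 2).
    rewrite -ler_pdivrMr//; apply: le_trans c1.
    by rewrite le_eqVlt; apply/orP; left; apply/eqP; field; rewrite gt_eqF.
  apply: ler_pM (ltW e24) (ltW del2) _ dlt.
  by rewrite ler_peMl// ltW.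
have iter_gain k : (k <= w)%N ->
    E (m - w + k)%N (vsum (comp_weight h)) <= h * n%:R - k%:R * gain.
  elim: k => [_|k IH kw].
    have Ei := expE (m - w)%N (leq_trans (leq_subr w m) mM).
    rewrite addn0 mul0r subr0 -(expect_cst Ei (h * n%:R)).
    by apply: (expect_le Ei) => G; exact: vsum_comp_weight_le.
  have sg : E (m - w + k).+1 (vsum (comp_weight h))
      <= E (m - w + k)%N (vsum (comp_weight h)) - gain.
    by apply: step_gain; [exact: leq_addr|rewrite -[X in (_ < X)%N](subnK wm) ltn_add2l].
  rewrite addnS; apply: le_trans sg _.
  by have := IH (ltnW kw); rewrite -natr1; lra.
have := iter_gain w (leqnn w); rewrite subnK//.
have := expect_ge0 (expE m mM) (@vsum_comp_weight_ge0 R n h h0).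
have hn : h * n%:R <= d * gain / 16 * n%:R by rewrite ler_pM2r.
have wg : d * n%:R / 8 * gain <= w%:R * gain by rewrite ler_pM2r.
have : 0 < d * gain * n%:R by exact: mulr_gt0.
by move: hn wg; clear; lra.
Qed.

End GiantComponent.

(** * Uniform subsets and draws with replacement as chains *)

Section Models.
Variable R : realType.

(** [B = pairs n :\: F] gives the uniform model; [B = pairs n] gives the Poisson model conditioned
    on the number of pairs hit. *)
Definition subset_mean (n : nat) (F B : graph n) (j : nat) (f : graph n -> R) : R :=
  (#|[set H : graph n | (H \subset B) && (#|H| == j)]|%:R)^-1 *
  \sum_(H : graph n | (H \subset B) && (#|H| == j)) f (F :|: H).

Lemma card_subsets (n : nat) (B : graph n) (j : nat) :
  #|[set H : graph n | (H \subset B) && (#|H| == j)]| = 'C(#|B|, j).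
Proof. exact: cards_draws. Qed.

Lemma subset_mean_expectation (n : nat) (F B : graph n) (j : nat) :
  (j <= #|B|)%N -> expectation (subset_mean F B j).
Proof.
move=> jB; rewrite /subset_mean card_subsets.
have c0 : 0 < 'C(#|B|, j)%:R :> R by rewrite ltr0n bin_gt0.
have cE : \sum_(H : graph n | (H \subset B) && (#|H| == j)) 1 = 'C(#|B|, j)%:R :> R.
  rewrite -card_subsets -sum1_card natr_sum; apply: eq_bigl => H.
  by rewrite inE.
split.
- by rewrite cE mulVf// gt_eqF.
- by move=> f g fg; rewrite ler_wpM2l ?invr_ge0 ?(ltW c0)//; apply: ler_sum.
- move=> a f g; rewrite big_split/= -big_distrr/=; ring.
Qed.

Lemma sum_subsets_step (n : nat) (B : graph n) (j : nat) (g : graph n -> R) :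
  \sum_(H : graph n | (H \subset B) && (#|H| == j)) \sum_(e in B :\: H) g (e |: H) =
  j.+1%:R * \sum_(H : graph n | (H \subset B) && (#|H| == j.+1)) g H.
Proof.
transitivity (\sum_(K : graph n | (K \subset B) && (#|K| == j.+1)) \sum_(e in K) g K);
  last first.
  rewrite big_distrr/=; apply: eq_bigr => K /andP[_ /eqP cK].
  by rewrite sumr_const cK mulr_natl.
rewrite (exchange_big_dep xpredT)//= [RHS](exchange_big_dep xpredT)//=.
apply: eq_bigr => e _.
rewrite (reindex_onto (fun K => K :\ e) (fun H => e |: H)); last first.
  move=> H /andP[_]; rewrite in_setD => /andP[eH _].
  exact: setU1K.
apply: eq_big => K; last by move=> /andP[_ /eqP ->].
rewrite !inE eqxx /=.
have [eK|eK] := boolP (e \in K); last first.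
  rewrite andbF; apply/negbTE; apply: contra eK => /andP[_ /eqP <-].
  by rewrite !inE eqxx.
rewrite setD1K// eqxx !andbT.
rewrite [in RHS](cardsD1 e) eK add1n eqSS.
have -> : (K \subset B) = (e \in B) && (K :\ e \subset B).
  by rewrite -{1}(setD1K eK) subUset sub1set.
by case: (e \in B) => /=; rewrite ?andbT ?andbF.
Qed.

(** A uniform [j]-subset of [B] with a uniform further element is a uniform subset of size [j + 1].
    Pairs outside [B :\: H] already lie in [F :|: H], so summing over [B :\: H] yields the full
    generator. *)
Lemma subset_mean_step (n : nat) (F B : graph n) (j : nat) (f : graph n -> R) :
  pairs n :\: F \subset B -> B \subset pairs n -> (j < #|B|)%N ->
  subset_mean F B j.+1 f = subset_mean F B j f
    + (#|B| - j)%:R^-1 * subset_mean F B j (edge_gen f).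
Proof.
move=> FB Bp jB; rewrite /subset_mean !card_subsets.
have c0 : ('C(#|B|, j)%:R : R) != 0 by rewrite pnatr_eq0 -lt0n bin_gt0 ltnW.
have c1 : ('C(#|B|, j.+1)%:R : R) != 0 by rewrite pnatr_eq0 -lt0n bin_gt0.
have d0 : ((#|B| - j)%:R : R) != 0 by rewrite pnatr_eq0 -lt0n subn_gt0.
have binE : j.+1%:R * 'C(#|B|, j.+1)%:R = (#|B| - j)%:R * 'C(#|B|, j)%:R :> R.
  by rewrite -!natrM mul_bin_left.
set S1 := \sum_(H | _) f _; set S0 := \sum_(H | _) f _.
have -> : \sum_(H : graph n | (H \subset B) && (#|H| == j)) edge_gen f (F :|: H) =
    j.+1%:R * S1 - (#|B| - j)%:R * S0.
  rewrite -(sum_subsets_step B j (fun H => f (F :|: H))) /S0 big_distrr -sumrB/=.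
  apply: eq_bigr => H /andP[HB /eqP cH].
  rewrite /edge_gen (bigID (mem (B :\: H)))/= [X in _ + X]big1 ?addr0; last first.
    move=> e /andP[eP]; rewrite in_setD negb_and negbK => eBH.
    suff eG : e \in F :|: H by rewrite (finset.setUidPr _) ?subrr// sub1set.
    rewrite inE; case/orP: eBH => [->|eB]; first by rewrite orbT.
    apply/orP; left; apply: contraNT eB => eF; apply: (subsetP FB).
    by rewrite in_setD eF.
  rewrite (eq_bigl (mem (B :\: H))); last first.
    move=> e /=; rewrite andb_idl// in_setD => /andP[_]; exact: (subsetP Bp).
  rewrite sumrB sumr_const cardsD (finset.setIidPr HB) cH mulr_natl.
  by congr (_ - _); apply: eq_bigr => e _; rewrite finset.setUCA.
have -> : ('C(#|B|, j.+1)%:R)^-1 = j.+1%:R / ((#|B| - j)%:R * 'C(#|B|, j)%:R) :> R.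
  by rewrite -binE invfM mulrA divff ?mul1r// pnatr_eq0.
move: (#|B| - j)%:R d0 j.+1%:R ('C(#|B|, j)%:R) c0 => d d0 a b c0.
by field; rewrite c0 d0.
Qed.

Definition draw_mean (n : nat) (F : graph n) (j : nat) (f : graph n -> R) : R :=
  (#|pairs n|%:R ^+ j)^-1 *
  \sum_(g : {ffun 'I_j -> {set 'I_n}} | [forall i, g i \in pairs n])
     f (F :|: [set g i | i : 'I_j]).

Lemma draw_mean0 (n : nat) (F : graph n) (f : graph n -> R) : draw_mean F 0 f = f F.
Proof.
rewrite /draw_mean expr0 invr1 mul1r (big_pred1 [ffun i : 'I_0 => set0]).
  congr f; apply/setP => e; rewrite inE; case: imsetP => [[[]//]|_].
  by rewrite orbF.
move=> g /=; apply/forallP/eqP => [_|_ []//].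
by apply/ffunP => -[].
Qed.

Lemma draw_mean_step (n : nat) (F : graph n) (j : nat) (f : graph n -> R) :
  (0 < #|pairs n|)%N ->
  draw_mean F j.+1 f = draw_mean F j f
    + #|pairs n|%:R^-1 * draw_mean F j (edge_gen f).
Proof.
move=> N0; have NR : (#|pairs n|%:R : R) != 0 by rewrite pnatr_eq0 -lt0n.
pose T := {set 'I_n}.
pose ext (p : {ffun 'I_j -> T} * T) : {ffun 'I_j.+1 -> T} :=
  [ffun i => oapp p.1 p.2 (unlift ord_max i)].
have extB : bijective ext.
  exists (fun g : {ffun 'I_j.+1 -> T} =>
    ([ffun i : 'I_j => g (lift ord_max i)], g ord_max)).
    move=> [g e]; rewrite /ext ffunE unlift_none/=; congr (_, _).
    by apply/ffunP => i; rewrite !ffunE liftK.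
  move=> g; apply/ffunP => i; rewrite ffunE.
  by case: unliftP => [k ->|->]/=; rewrite ?ffunE.
rewrite /draw_mean (reindex ext); last exact: onW_bij.
have extP p : [forall i, ext p i \in pairs n] =
    [forall i, p.1 i \in pairs n] && (p.2 \in pairs n).
  apply/forallP/andP => [h|[/forallP h1 h2] i].
    split; last by have := h ord_max; rewrite ffunE unlift_none.
    by apply/forallP => i; have := h (lift ord_max i); rewrite ffunE liftK.
  by rewrite ffunE; case: unliftP => [k _|_]/=.
have extI p : [set ext p i | i : 'I_j.+1] = p.2 |: [set p.1 i | i : 'I_j].
  apply/setP => e; rewrite !inE; apply/imsetP/orP => [[i _ ->]|].
    rewrite ffunE; case: unliftP => [k _|_]/=; last by left.
    by right; exact: imset_f.
  case=> [/eqP->|/imsetP[i _ ->]].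
    by exists ord_max => //; rewrite ffunE unlift_none.
  by exists (lift ord_max i) => //; rewrite ffunE liftK.
rewrite (eq_bigl _ _ extP) (eq_bigr (fun p : {ffun 'I_j -> T} * T =>
  f (p.2 |: (F :|: [set p.1 i | i : 'I_j])))); last first.
  by move=> p _; rewrite extI finset.setUCA.
rewrite -(pair_big (fun g : {ffun 'I_j -> T} => [forall i, g i \in pairs n])
  (fun e => e \in pairs n)
  (fun g e => f (e |: (F :|: [set g i | i : 'I_j]))))/=.
set S0 := \sum_(g | _) f _; set S1 := \sum_(g | _) \sum_(e | _) _.
have -> : \sum_(g : {ffun 'I_j -> T} | [forall i, g i \in pairs n])
    edge_gen f (F :|: [set g i | i : 'I_j]) = S1 - #|pairs n|%:R * S0.
  rewrite /S1 /S0 big_distrr -sumrB/=; apply: eq_bigr => g _.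
  by rewrite /edge_gen sumrB sumr_const mulr_natl.
by rewrite exprS; field; rewrite NR expf_neq0.
Qed.

Lemma draw_mean_expectation (n : nat) (F : graph n) (j : nat) :
  (0 < #|pairs n|)%N -> expectation (draw_mean F j).
Proof.
move=> N0; have c0 : 0 < #|pairs n|%:R ^+ j :> R by rewrite exprn_gt0// ltr0n.
split.
(* Normalisation comes from the step formula, since the generator kills constants. *)
- elim: j {c0} => [|j IH]; first by rewrite draw_mean0.
  rewrite draw_mean_step// IH /draw_mean big1 ?mulr0 ?addr0// => g _.
  by rewrite /edge_gen big1// => e _; rewrite subrr.
- by move=> f g fg; rewrite ler_wpM2l ?invr_ge0 ?(ltW c0)//; apply: ler_sum.
- move=> a f g; rewrite /draw_mean big_split/= -big_distrr/=; ring.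
Qed.

(** Here [q] is the number of pairs available for the next edge, [1 / q] the rate. With [m = 1 / n]
    the product expands to [1 + 2 C' m (1 - 4 C' m)], which is at least 1. *)
Lemma inv_quadratic_le (n C' q : R) : 0 < n -> 0 <= C' -> 4 * C' <= n ->
  n ^+ 2 / 2 - C' * n <= q -> 0 < q ->
  q^-1 <= 2 * n^-1 ^+ 2 + 8 * C' * n^-1 ^+ 3.
Proof.
move=> n0 C0 Cn nq q0.
have [m mE] : exists m, m = n^-1 by eexists.
have nm : n * m = 1 by rewrite mE divff// gt_eqF.
have m0 : 0 < m by rewrite mE invr_gt0.
rewrite -mE -[leLHS]div1r ler_pdivrMr//.
have r0 : 0 <= 2 * m ^+ 2 + 8 * C' * m ^+ 3.
  have m2 := exprn_ge0 2 (ltW m0); have m3 := exprn_ge0 3 (ltW m0).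
  by apply: addr_ge0; apply: mulr_ge0 => //; exact: mulr_ge0.
apply: le_trans (ler_wpM2l r0 nq).
have -> : (2 * m ^+ 2 + 8 * C' * m ^+ 3) * (n ^+ 2 / 2 - C' * n) =
  (n * m) ^+ 2 + 4 * C' * m * (n * m) ^+ 2 - 2 * C' * m * (n * m)
    - 8 * C' ^+ 2 * m ^+ 2 * (n * m) by field.
rewrite nm expr1n !mulr1.
have : 0 <= 2 * C' * m * (1 - 4 * C' * m).
  apply: mulr_ge0; first by apply: mulr_ge0; [exact: mulr_ge0|exact: ltW].
  by rewrite subr_ge0 mE ler_pdivrMr// mul1r.
by lra.
Qed.

End Models.

(** * Binomial averages and Chebyshev's inequality for them *)

Section Binomial.
Variables (R : realType) (p : R).

Definition bin_mean (N : nat) (g : nat -> R) : R :=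
  \sum_(j < N.+1) 'C(N, j)%:R * p ^+ j * (1 - p) ^+ (N - j) * g j.

Lemma bin_mean_rec (N : nat) (g : nat -> R) :
  bin_mean N.+1 g = p * bin_mean N (fun j => g j.+1) + (1 - p) * bin_mean N g.
Proof.
rewrite /bin_mean big_ord_recl/= bin0 expr0 subn0.
rewrite (eq_bigr (fun j : 'I_N.+1 =>
   p * ('C(N, j)%:R * p ^+ j * (1 - p) ^+ (N - j) * g j.+1)
   + 'C(N, j.+1)%:R * p ^+ j.+1 * (1 - p) ^+ (N - j) * g j.+1)); last first.
  by move=> j _; rewrite /bump/= add1n binS natrD subSS exprS; ring.
rewrite big_split/= -big_distrr/= addrCA; congr (_ + _).
rewrite big_ord_recr/= bin_small// !mul0r addr0.
rewrite [in RHS]big_ord_recl/= bin0 expr0 subn0 mulrDr; congr (_ + _).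
  by rewrite exprS; ring.
rewrite big_distrr/=; apply: eq_bigr => j _; rewrite /bump/= add1n.
by rewrite -{1}(subnSK (ltn_ord j)) [(1 - p) ^+ _.+1]exprS; ring.
Qed.

Lemma bin_mean1 (N : nat) : bin_mean N (fun=> 1) = 1.
Proof.
elim: N => [|N IH]; last by rewrite bin_mean_rec IH; ring.
by rewrite /bin_mean big_ord_recl big_ord0/= bin0 !expr0 !mulr1 addr0.
Qed.

(** The centre [a] is arbitrary because a successful trial shifts it by 1 in the induction. *)
Lemma bin_mean_sqr (N : nat) (a : R) :
  bin_mean N (fun j => (j%:R - a) ^+ 2) = N%:R * p * (1 - p) + (N%:R * p - a) ^+ 2.
Proof.
elim: N a => [|N IH] a.
  by rewrite /bin_mean big_ord_recl big_ord0/= bin0 subn0 !expr0; ring.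
rewrite bin_mean_rec IH.
have -> : bin_mean N (fun j => (j.+1%:R - a) ^+ 2) =
    bin_mean N (fun j => (j%:R - (a - 1)) ^+ 2).
  by apply: eq_bigr => j _; rewrite -natr1; congr (_ * _ ^+ 2); ring.
by rewrite IH -natr1; ring.
Qed.

Hypothesis p01 : 0 <= p <= 1.

Lemma bin_weight_ge0 (N j : nat) : 0 <= 'C(N, j)%:R * p ^+ j * (1 - p) ^+ (N - j).
Proof.
have /andP[p0 p1] := p01.
by apply: mulr_ge0; [apply: mulr_ge0|]; rewrite ?exprn_ge0// subr_ge0.
Qed.

Lemma bin_mean_le (N : nat) (f g : nat -> R) :
  (forall j, (j <= N)%N -> f j <= g j) -> bin_mean N f <= bin_mean N g.
Proof.
move=> fg; apply: ler_sum => j _; rewrite ler_wpM2l ?bin_weight_ge0//.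
by apply: fg; rewrite -ltnS.
Qed.

Lemma bin_mean_lin (N : nat) (a : R) (f g : nat -> R) :
  bin_mean N (fun j => a * f j + g j) = a * bin_mean N f + bin_mean N g.
Proof. by rewrite /bin_mean big_distrr -big_split/=; apply: eq_bigr => j _; ring. Qed.

Lemma bin_mean_window (N : nat) (g : nat -> R) (a del : R) : 0 < a -> 0 <= del ->
  (forall j, (j <= N)%N -> g j <= 1) ->
  (forall j, (j <= N)%N -> `|j%:R - N%:R * p| < a -> g j <= del) ->
  bin_mean N g <= del + N%:R * p / a ^+ 2.
Proof.
move=> a0 del0 g1 gd.
have a2 : 0 < a ^+ 2 by exact: exprn_gt0.
apply: (@le_trans _ _ (bin_mean N
  (fun j => (a ^+ 2)^-1 * (j%:R - N%:R * p) ^+ 2 + del * 1))).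
  apply: bin_mean_le => j jN; rewrite mulr1.
  have [h|h] := ltP `|j%:R - N%:R * p| a.
    apply: le_trans (gd j jN h) _; rewrite lerDr.
    by rewrite mulr_ge0 ?sqr_ge0// invr_ge0 ltW.
  apply: le_trans (g1 j jN) _; rewrite ler_wpDr//.
  rewrite mulrC ler_pdivlMr// mul1r -[leRHS]real_normK ?num_real//.
  by rewrite lerXn2r ?nnegrE// ltW.
rewrite bin_mean_lin bin_mean_sqr subrr expr0n/= addr0.
have -> : bin_mean N (fun=> del * 1) = del.
  transitivity (del * bin_mean N (fun=> 1)); last by rewrite bin_mean1 mulr1.
  by rewrite /bin_mean big_distrr/=; apply: eq_bigr => j _; ring.
rewrite addrC lerD2l mulrC ler_pM2r ?invr_gt0//.
have /andP[p0 p1] := p01.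
by rewrite ler_piMr ?mulr_ge0// gerBl.
Qed.

End Binomial.

(** * The Poisson model as a binomial mixture *)

Section Tilde.
Variable R : realType.

Definition tilde_mean (n : nat) (t : R) (F : graph n) (f : graph n -> R) : R :=
  bin_mean (1 - expR (- (t / n%:R))) #|pairs n|
    (fun j => subset_mean F (pairs n) j f).

(** The weight of [H] depends only on its cardinality; after grouping by it, the binomial
    coefficient cancels the normalisation of [subset_mean]. *)
Lemma Pr_tilde_mean (n : nat) (t : R) (F : graph n) (A : pred (graph n)) :
  Pr_tilde t F A = tilde_mean t F (ind A).
Proof.
rewrite /Pr_tilde /tilde_mean; set p := 1 - expR _; set N := #|pairs n|.
have subN (H : graph n) : H \subset pairs n -> (#|H| < N.+1)%N.
  by move=> HP; rewrite ltnS; exact: subset_leq_card.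
rewrite (partition_big (fun H : graph n => inord #|H| : 'I_N.+1) xpredT)//=.
apply: eq_bigr => j _; rewrite /subset_mean card_subsets -/N.
have c0 : ('C(N, j)%:R : R) != 0 by rewrite pnatr_eq0 -lt0n bin_gt0 -ltnS.
have cancel (b x y S : R) : b != 0 -> b * x * y * (b^-1 * S) = x * y * S.
  by move=> b0; field.
rewrite cancel//.
rewrite big_distrr/=; apply: eq_big => H.
  have [HP|//] := boolP (H \subset pairs n) => /=.
  by rewrite -val_eqE/= inordK// subN.
move=> /andP[HP /eqP ej]; congr (_ * _).
rewrite (bigID (mem H))/= (eq_bigl (mem H)); last first.
  by move=> e /=; rewrite andb_idl// => /(subsetP HP).
rewrite (eq_bigr (fun=> p)); last by move=> e /= ->.
rewrite prodr_const [X in _ * X](eq_bigr (fun=> 1 - p)); last first.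
  by move=> e /andP[_ /negbTE ->].
rewrite (eq_bigl (mem (pairs n :\: H))); last first.
  by move=> e /=; rewrite in_setD andbC.
rewrite prodr_const cardsD (finset.setIidPr HP) -/N.
by rewrite -ej inordK// subN.
Qed.

Lemma tilde_mean_expectation (n : nat) (t : R) (F : graph n) : 0 <= t ->
  expectation (tilde_mean t F).
Proof.
move=> t0; have p01 : 0 <= 1 - expR (- (t / n%:R)) <= 1.
  by rewrite oneB_expRN_ge0 ?divr_ge0//= gerBl expR_ge0.
split.
- rewrite /tilde_mean -[RHS](bin_mean1 (1 - expR (- (t / n%:R))) #|pairs n|).
  apply: eq_bigr => j _; congr (_ * _).
  by apply: expect1; apply: subset_mean_expectation; rewrite -ltnS.
- move=> f g fg; apply: bin_mean_le => // j jN.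
  exact: (expect_le (subset_mean_expectation R F jN)).
- move=> a f g; rewrite /tilde_mean -bin_mean_lin; apply: eq_bigr => j _.
  congr (_ * _); apply: expect_lin; apply: subset_mean_expectation.
  by rewrite -ltnS.
Qed.

End Tilde.

(** * The giant component in the two discrete models *)

Section ModelChains.
Variable R : realType.

Definition far (n : nat) (rho eps : R) : pred (graph n) :=
  fun G => ~~ (`|(C1 G)%:R / n%:R - rho| <= eps).

Lemma giant_component (C t eps del : R) :
  0 <= C -> 0 < t -> 0 < eps -> 0 < del ->
  exists2 eta : R, 0 < eta & exists n0 : nat, forall (n : nat) (F : graph n)
      (M : nat) (E : nat -> (graph n -> R) -> R) (m : nat) (rho : R),
    (0 < n)%N -> (n0 <= n)%N -> edge_chain F M C E -> (m <= M)%N ->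
    `|2 * m%:R / n%:R - t| <= eta -> giant_fraction F t rho ->
    E m (ind (far rho eps)) <= del.
Proof.
move=> C0 t0 eps0 del0; have del2 : 0 < del / 2 by lra.
have [eta1 eta10 [n1 up]] := giant_upper C0 t0 eps0 del2.
have [eta2 eta20 [n2 lo]] := giant_lower C0 t0 eps0 del2.
exists (Num.min eta1 eta2); first by rewrite lt_min eta10.
exists (maxn n1 n2) => n F M E m rho n0; rewrite geq_max le_min.
move=> /andP[nn1 nn2] chE mM /andP[m1 m2] gf.
have Em : expectation (E m) by case: chE => H _ _; exact: H.
have := lerD (up n F M E m rho n0 nn1 chE mM m1 gf) (lo n F M E m rho n0 nn2 chE mM m2 gf).
rewrite -(expectD Em) -splitr; apply: le_trans; apply: (expect_le Em) => G.
rewrite /ind /far -natrD ler_nat ler_norml negb_and -!ltNge.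
rewrite ltrBlDr [- eps + rho]addrC -(ltrD2r rho eps) subrK [eps + rho]addrC.
by case: (_ < rho - eps); case: (rho + eps < _).
Qed.

Lemma simple_graph_edges_le (n : nat) (F : graph n) (K : R) : (0 < n)%N ->
  simple_graph F -> sk 2 F <= K -> #|F|%:R <= K * n%:R.
Proof.
move=> n0 sF; rewrite sk_avg -ler_pdivlMl ?invr_gt0 ?ltr0n// invrK mulrC.
move=> h; apply: le_trans h.
rewrite (eq_bigr (fun v => (csize F v)%:R)) => [|v _]; last exact: expr1.
by rewrite -natr_sum ler_nat; exact: simple_graph_card_le.
Qed.

(** At least [n ^ 2 / 2 - (K + T + 1) n] pairs stay available: [K n] bounds those occupied by [F],
    [T n] those already drawn, and the last [n] covers the difference between [n ^ 2 / 2] and the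
    number of pairs. The factor 8 is that of [inv_quadratic_le]. *)
Lemma subset_chain (K T : R) : 0 <= K -> 0 <= T ->
  exists n0 : nat, forall (n : nat) (F B : graph n), (0 < n)%N -> (n0 <= n)%N ->
    simple_graph F -> sk 2 F <= K -> pairs n :\: F \subset B -> B \subset pairs n ->
    (Num.truncn (T * n%:R) <= #|B|)%N /\
    edge_chain F (Num.truncn (T * n%:R)) (8 * (K + T + 1)) (subset_mean F B).
Proof.
move=> K0 T0; have [n0 n0P] := eventually_ge (4 * (K + T + 1)).
exists n0 => n F B n_gt0 nn0 sF sK FB Bp; set M := Num.truncn _.
have nR0 : 0 < n%:R :> R by rewrite ltr0n.
have MT : M%:R <= T * n%:R by rewrite truncn_le mulr_ge0// ltW.
have n4 := n0P n nn0.
have C'0 : 0 <= K + T + 1 by rewrite !addr_ge0.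
have BN : #|pairs n|%:R - K * n%:R <= #|B|%:R :> R.
  rewrite lerBlDr; apply: le_trans (lerD (lexx _) (simple_graph_edges_le n_gt0 sF sK)).
  rewrite -natrD ler_nat -(cardsID F (pairs n)) addnC leq_add//.
    exact: subset_leq_card.
  by rewrite subset_leq_card// finset.subsetIr.
have big : n%:R ^+ 2 / 2 - (K + T + 1) * n%:R <= #|B|%:R - T * n%:R :> R.
  apply: le_trans (lerB BN (lexx _)); rewrite card_pairsE// -subr_ge0.
  rewrite [leRHS](_ : _ = n%:R / 2); last by field.
  by rewrite divr_ge0// ltW.
have pos : 0 < n%:R ^+ 2 / 2 - (K + T + 1) * n%:R :> R.
  have -> : n%:R ^+ 2 / 2 - (K + T + 1) * n%:R = (n%:R / 2 - (K + T + 1)) * n%:R.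
    by field.
  by apply: mulr_gt0 => //; move: n4 C'0 nR0; clear; lra.
have MB : (M <= #|B|)%N by rewrite -(ler_nat R); move: MT big pos; clear; lra.
split=> //; split.
- by move=> j jM; apply: subset_mean_expectation; exact: leq_trans MB.
- move=> f; rewrite /subset_mean card_subsets bin0 invr1 mul1r (big_pred1 finset.set0).
    by rewrite finset.setU0.
  by move=> H /=; rewrite cards_eq0; case: eqVneq => [->|]; rewrite ?finset.sub0set ?andbF.
move=> j jM; have jB : (j < #|B|)%N by exact: leq_trans MB.
have q0 : 0 < (#|B| - j)%:R :> R by rewrite ltr0n subn_gt0.
have jT : j%:R <= T * n%:R by apply: le_trans MT; rewrite ler_nat ltnW.
have qE : (#|B| - j)%:R = #|B|%:R - j%:R :> R by rewrite natrB// ltnW.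
exists (#|B| - j)%:R^-1; split.
- have n20 : 0 < n%:R ^+ 2 / 2 :> R by rewrite divr_gt0// exprn_gt0.
  have -> : 2 * n%:R^-1 ^+ 2 = (n%:R ^+ 2 / 2)^-1 :> R by rewrite invf_div exprVn.
  rewrite lef_pV2//; apply: le_trans (card_pairs_le R n_gt0).
  rewrite ler_nat; apply: leq_trans (leq_subr _ _) _; exact: subset_leq_card.
- apply: inv_quadratic_le => //.
  by rewrite qE; move: big jT; clear; lra.
- by move=> f; exact: subset_mean_step.
Qed.

Lemma draw_chain : exists n0 : nat, forall (n : nat) (F : graph n) (M : nat),
  (0 < n)%N -> (n0 <= n)%N -> edge_chain F M 8 (draw_mean F : nat -> (graph n -> R) -> R).
Proof.
have [n0 n0P] := @eventually_ge R 4.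
exists n0 => n F M n_gt0 nn0; have n4 := n0P n nn0.
have nR0 : 0 < n%:R :> R by rewrite ltr0n.
have NR : 0 < #|pairs n|%:R :> R.
  by rewrite card_pairsE// divr_gt0// mulr_gt0//; lra.
have N0 : (0 < #|pairs n|)%N by move: NR; rewrite ltr0n.
split; first by move=> j _; exact: draw_mean_expectation.
  exact: draw_mean0.
move=> j _; exists #|pairs n|%:R^-1; split.
- have n20 : 0 < n%:R ^+ 2 / 2 :> R by rewrite divr_gt0// exprn_gt0.
  have -> : 2 * n%:R^-1 ^+ 2 = (n%:R ^+ 2 / 2)^-1 :> R by rewrite invf_div exprVn.
  by rewrite lef_pV2//; exact: card_pairs_le.
- rewrite -[8]mulr1; apply: inv_quadratic_le => //; first by rewrite mulr1.
  by rewrite card_pairsE//; move: nR0; clear; lra.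
- by move=> f; exact: draw_mean_step.
Qed.

Lemma truncn_half_near (t eta : R) : 0 < t -> 0 < eta ->
  exists n0 : nat, forall n : nat, (0 < n)%N -> (n0 <= n)%N ->
    `|2 * (Num.truncn (n%:R * t / 2))%:R / n%:R - t| <= eta.
Proof.
move=> t0 eta0; have [n0 n0P] := eventually_ge (2 / eta).
exists n0 => n n_gt0 nn0; have nR0 : 0 < n%:R :> R by rewrite ltr0n.
have n2 : 2 <= n%:R * eta by rewrite -ler_pdivrMr ?n0P.
set m := Num.truncn _.
have m1 : m%:R <= n%:R * t / 2.
  by rewrite truncn_le divr_ge0// mulr_ge0// ltW.
have m2 : n%:R * t / 2 < m%:R + 1 by rewrite natr1 truncnS_gt.
clearbody m; rewrite ler_norml lerBrDr lerBlDr ler_pdivlMr// ler_pdivrMr//.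
have : 0 < n%:R * eta by exact: mulr_gt0.
by move=> ne; clear - m1 m2 n2 ne; apply/andP; split; lra.
Qed.

Lemma unif_giant (K t eps del : R) : 0 <= K -> 0 < t -> 0 < eps -> 0 < del ->
  exists n0 : nat, forall (n : nat) (F : graph n), (0 < n)%N -> (n0 <= n)%N ->
    simple_graph F -> sk 2 F <= K ->
    let E := subset_mean F (pairs n :\: F) (Num.truncn (n%:R * t / 2)) in
    expectation E /\
    forall rho, giant_fraction F t rho -> E (ind (far rho eps)) <= del.
Proof.
move=> K0 t0 eps0 del0.
have C0 : 0 <= 8 * (K + t + 1) by apply: mulr_ge0 => //; rewrite !addr_ge0// ltW.
have [eta eta0 [n1 gc]] := giant_component C0 t0 eps0 del0.
have [n2 sc] := subset_chain K0 (ltW t0).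
have [n3 tn] := truncn_half_near t0 eta0.
exists (maxn n1 (maxn n2 n3)) => n F n_gt0; rewrite !geq_max.
move=> /and3P[nn1 nn2 nn3] sF sK E.
have [MB chE] := sc n F _ n_gt0 nn2 sF sK (subxx _) (finset.subsetDl _ _).
have mM : (Num.truncn (n%:R * t / 2) <= Num.truncn (t * n%:R))%N.
  apply: le_truncn; rewrite [n%:R * t]mulrC -mulrA ler_wpM2l ?(ltW t0)//.
  by rewrite ler_pdivrMr// ler_peMr// ler1n.
split; first by case: chE => H _ _; exact: H.
by move=> rho gf; apply: gc chE mM (tn n n_gt0 nn3) gf.
Qed.

Lemma star_giant (t eps del : R) : 0 < t -> 0 < eps -> 0 < del ->
  exists n0 : nat, forall (n : nat) (F : graph n), (0 < n)%N -> (n0 <= n)%N ->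
    let E := draw_mean F (Num.truncn (n%:R * t / 2)) in
    expectation E /\
    forall rho, giant_fraction F t rho -> E (ind (far rho eps)) <= del.
Proof.
move=> t0 eps0 del0.
have [eta eta0 [n1 gc]] := giant_component (ler0n R 8) t0 eps0 del0.
have [n2 dc] := draw_chain.
have [n3 tn] := truncn_half_near t0 eta0.
exists (maxn n1 (maxn n2 n3)) => n F n_gt0; rewrite !geq_max.
move=> /and3P[nn1 nn2 nn3] E.
have chE := dc n F (Num.truncn (n%:R * t / 2)) n_gt0 nn2.
split; first by case: chE => H _ _; exact: H.
by move=> rho gf; apply: gc chE (leqnn _) (tn n n_gt0 nn3) gf.
Qed.

End ModelChains.

(** * The giant component in the Poisson model *)

Section TildeGiant.
Variable R : realType.

Lemma tilde_edge_mean (n : nat) (t : R) : (0 < n)%N -> 0 < t ->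
  let a := #|pairs n|%:R * (1 - expR (- (t / n%:R))) in
  a <= t * n%:R / 2 /\ t - (t + t ^+ 2 / 2) / n%:R <= 2 * a / n%:R.
Proof.
move=> n_gt0 t0; have nR0 : 0 < n%:R :> R by rewrite ltr0n.
have n_neq0 : n%:R != 0 :> R by rewrite gt_eqF.
have tn0 : 0 <= t / n%:R by rewrite divr_ge0// ltW.
have p0 := oneB_expRN_ge0 tn0.
have p1 := oneB_expRN_le (t / n%:R).
have p2 : t / n%:R - (t / n%:R) ^+ 2 / 2 <= 1 - expR (- (t / n%:R)).
  by have := expRN_le2 tn0; lra.
move: (1 - expR _) p0 p1 p2 => p p0 p1 p2 /=; split.
  apply: le_trans (ler_pM _ p0 (card_pairs_le R n_gt0) p1) _ => //.
  rewrite le_eqVlt; apply/orP; left; apply/eqP.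
  by field.
rewrite card_pairsE//.
have -> : 2 * (n%:R * (n%:R - 1) / 2 * p) / n%:R = n%:R * p - p by field.
have := ler_wpM2l (ltW nR0) p2.
have -> : n%:R * (t / n%:R - (t / n%:R) ^+ 2 / 2) = t - t ^+ 2 / 2 / n%:R.
  by field.
have -> : (t + t ^+ 2 / 2) / n%:R = t / n%:R + t ^+ 2 / 2 / n%:R by field.
by move: p1; clear; lra.
Qed.

Lemma tilde_giant (K t eps del : R) : 0 <= K -> 0 < t -> 0 < eps -> 0 < del ->
  exists n0 : nat, forall (n : nat) (F : graph n), (0 < n)%N -> (n0 <= n)%N ->
    simple_graph F -> sk 2 F <= K ->
    expectation (tilde_mean t F) /\
    forall rho, giant_fraction F t rho -> tilde_mean t F (ind (far rho eps)) <= del.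
Proof.
move=> K0 t0 eps0 del0; have del2 : 0 < del / 2 by lra.
have T0 : 0 <= t + 1 by rewrite addr_ge0// ltW.
have C0 : 0 <= 8 * (K + (t + 1) + 1).
  by apply: mulr_ge0 => //; rewrite !addr_ge0// ltW.
have [eta' eta'0 [n1 gc]] := giant_component C0 t0 eps0 del2.
(* Capped at 1 so that every [j] of the window fits into the chain of length about [(t + 1) n]. Half
   of [eta] pays for the window, half for the distance from the binomial mean to [t n / 2]. *)
pose eta := Num.min eta' 1.
have eta0 : 0 < eta by rewrite /eta lt_min eta'0 ltr01.
have eta1 : eta <= 1 by rewrite /eta ge_min lexx orbT.
have etaE : eta <= eta' by rewrite /eta ge_min lexx.
clearbody eta.
have [n2 sc] := subset_chain K0 T0.
have [n3 n3P] := eventually_ge ((t + t ^+ 2 / 2) / (eta / 2)).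
(* Chebyshev bounds the probability of leaving the window by [(t n / 2) / (eta n / 4) ^ 2 = 8 t /
   (eta ^ 2 n)], which must be at most [del / 2]. *)
have [n4 n4P] := eventually_ge (16 * t / (eta ^+ 2 * del)).
exists (maxn (maxn n1 n2) (maxn n3 n4)) => n F n_gt0; rewrite !geq_max.
move=> /andP[/andP[nn1 nn2] /andP[nn3 nn4]] sF sK.
split; first by apply: tilde_mean_expectation; exact: ltW.
move=> rho gf.
have nR0 : 0 < n%:R :> R by rewrite ltr0n.
have [MB chE] := sc n F (pairs n) n_gt0 nn2 sF sK (finset.subsetDl _ _) (subxx _).
have [a1 a2] := tilde_edge_mean n_gt0 t0.
have a0 : 0 < eta * n%:R / 4 by rewrite divr_gt0// mulr_gt0.
have p01 : 0 <= 1 - expR (- (t / n%:R)) <= 1.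
  by rewrite oneB_expRN_ge0 ?divr_ge0 ?(ltW t0)//= gerBl expR_ge0.
set p := 1 - expR _ in a1 a2 p01 *.
have close : (t + t ^+ 2 / 2) / n%:R <= eta / 2.
  have e2 : 0 < eta / 2 by lra.
  by rewrite ler_pdivrMr// -ler_pdivrMl// mulrC n3P.
have win (j : nat) : (j <= #|pairs n|)%N ->
    `|j%:R - #|pairs n|%:R * p| < eta * n%:R / 4 ->
    subset_mean F (pairs n) j (ind (far rho eps)) <= del / 2.
  move=> jN jw.
  have jt : `|2 * j%:R / n%:R - t| <= eta.
    have h1 : `|2 * j%:R / n%:R - 2 * (#|pairs n|%:R * p) / n%:R| <= eta / 2.
      rewrite -mulrBl -mulrBr !normrM normfV !(ger0_norm (ler0n _ _)).
      by rewrite ler_pdivrMr//; move: jw; clear; lra.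
    have h2 : 2 * (#|pairs n|%:R * p) / n%:R <= t.
      by rewrite ler_pdivrMr//; move: a1; clear; lra.
    move: h1; rewrite !ler_norml => /andP[h3 h4].
    by clear - h2 h3 h4 a2 close eta0; apply/andP; split; lra.
  apply: gc n_gt0 nn1 chE _ _ gf; last exact: le_trans etaE.
  rewrite truncn_ge_nat; last by rewrite mulr_ge0// ltW.
  move: jt; rewrite ler_norml => /andP[_]; rewrite lerBlDr ler_pdivrMr//.
  have : eta * n%:R <= n%:R by rewrite ler_piMl// ltW.
  have : 0 < t * n%:R by exact: mulr_gt0.
  by move: nR0; clear; lra.
have le1 (j : nat) : (j <= #|pairs n|)%N ->
    subset_mean F (pairs n) j (ind (far rho eps)) <= 1 :> R.
  move=> jN.
  have Ej : expectation (@subset_mean R n F (pairs n) j) by exact: subset_mean_expectation.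
  rewrite -[leRHS](expect1 Ej); apply: (expect_le Ej) => G.
  by rewrite /ind lern1; case: (far _ _ _).
apply: le_trans (bin_mean_window p01 a0 (ltW del2) le1 win) _.
have e2 : 0 < eta ^+ 2 by exact: exprn_gt0.
have tail : #|pairs n|%:R * p / (eta * n%:R / 4) ^+ 2 <= del / 2.
  rewrite ler_pdivrMr; last exact: exprn_gt0.
  apply: le_trans a1 _.
  have := n4P n nn4; rewrite ler_pdivrMr; last exact: mulr_gt0.
  move=> /(ler_wpM2r (ltW nR0)).
  have -> : del / 2 * (eta * n%:R / 4) ^+ 2 = n%:R * (eta ^+ 2 * del) * n%:R / 32.
    by field.
  by clear; lra.
by move: tail; clear; lra.
Qed.

End TildeGiant.

(** * Uniform margins in the explicit bounds *)

Section SurvivalGaps.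
Variables (R : realType) (n : nat) (F : graph n) (t rho c K : R).
Hypotheses (n_gt0 : (0 < n)%N) (t_gt0 : 0 < t).
Hypotheses (rho_gt0 : 0 < rho) (rhoE : rho = 1 - expZ F (rho * t)).
Let delta : R := t - (sk 2 F)^-1.
Hypotheses (delta_gt0 : 0 < delta) (c_ge0 : 0 <= c) (c_le : c <= delta).
Hypothesis K_ge : sk 3 F <= K.
Let lead : R := 2 * delta * (sk 2 F ^+ 3 / sk 3 F).
Let y := delta * sk 2 F.

Let s2_ge1 : 1 <= sk 2 F :> R. Proof. exact: sk_ge1. Qed.
Let s3_ge1 : 1 <= sk 3 F :> R. Proof. exact: sk_ge1. Qed.

Let lead_ge : 2 * c / K <= lead.
Proof.
have s30 : 0 < sk 3 F :> R by exact: lt_le_trans ltr01 s3_ge1.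
rewrite /lead mulrA; apply: ler_pM.
- exact: mulr_ge0.
- by rewrite invr_ge0; apply: le_trans K_ge; exact: ltW.
- apply: (@le_trans _ _ (2 * delta)); first by rewrite ler_pM2l.
  rewrite ler_peMr ?mulr_ge0 ?(ltW delta_gt0)//; exact: exprn_ege1.
- by rewrite lef_pV2 ?posrE// (lt_le_trans s30).
Qed.

Let frac_ge : c / (1 + c) <= y / (1 + y).
Proof.
have cy : c <= y.
  by apply: le_trans c_le _; rewrite /y ler_peMr// ltW.
have c1 : 0 < 1 + c by rewrite ltr_wpDr.
have y1 : 0 < 1 + y by rewrite (lt_le_trans c1)// lerD2l.
by rewrite ler_pdivrMr// mulrAC ler_pdivlMr//; lra.
Qed.

Let y_gt0 : 0 < y.
Proof. by rewrite mulr_gt0// (lt_le_trans ltr01). Qed.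

Let lead_ge0 : 0 <= 2 * c / K.
Proof.
apply: divr_ge0; first exact: mulr_ge0.
by apply: le_trans K_ge; apply: le_trans s3_ge1.
Qed.

Let frac_ge0 : 0 <= c / (1 + c).
Proof. by rewrite divr_ge0// addr_ge0. Qed.

(** [1 / (1 + y) ^ 2] exceeds [1 - 2 y] by at least [(y / (1 + y)) ^ 2], and [lead >= 2 c / K],
    [y >= c]. The resulting margin is the same for all graphs and absorbs the [o_p(1)] in (iv);
    [c = 0] gives (iii). *)
Lemma lower_gap :
  lead * (1 - 2 * delta * sk 2 F) + 2 * c / K * (c / (1 + c)) ^+ 2 <= rho.
Proof.
apply: le_trans (survival_lower n_gt0 t_gt0 rho_gt0 rhoE delta_gt0).
rewrite -/delta -/lead -/y.
have -> : 1 - 2 * delta * sk 2 F = 1 - 2 * y by rewrite /y; ring.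
have h1 : 2 * c / K * (c / (1 + c)) ^+ 2 <= lead * (y / (1 + y)) ^+ 2.
  apply: ler_pM => //; first exact: exprn_ge0.
  by rewrite lerXn2r ?nnegrE// (le_trans frac_ge0).
have y1 : 0 < 1 + y by rewrite addr_gt0.
have l0 : 0 <= lead by exact: le_trans lead_ge.
apply: le_trans (lerD (lexx _) h1) _.
rewrite -mulrDr ler_wpM2l// expr_div_n.
suff gen (u : R) : 0 < u -> 1 - 2 * u + u ^+ 2 / (1 + u) ^+ 2 <= ((1 + u) ^+ 2)^-1.
  exact: gen.
move=> u0; rewrite -subr_ge0.
have -> : ((1 + u) ^+ 2)^-1 - (1 - 2 * u + u ^+ 2 / (1 + u) ^+ 2) =
  (2 * u ^+ 2 + 2 * u ^+ 3) / (1 + u) ^+ 2 by field; rewrite gt_eqF// addr_gt0.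
apply: divr_ge0; last by rewrite exprn_ge0// addr_ge0// ltW.
by apply: addr_ge0; apply: mulr_ge0 => //; rewrite exprn_ge0// ltW.
Qed.

Let ratio : R := sk 2 F ^+ 2 * sk 4 F / sk 3 F ^+ 2.

Lemma upper_gap : delta * ratio <= 3 / 8 ->
  rho + 2 * c / K * (c / (1 + c)) <= lead * (1 + 8 / 3 * delta * ratio).
Proof.
move=> hr; have := survival_upper n_gt0 t_gt0 rho_gt0 rhoE delta_gt0 hr.
rewrite -/delta -/lead -/y -/ratio => h.
have s4_ge1 : 1 <= sk 4 F :> R by exact: sk_ge1.
have r0 : 0 <= 8 / 3 * delta * ratio.
  apply: mulr_ge0; first by apply: mulr_ge0 => //; exact: ltW.
  apply: divr_ge0; last exact: sqr_ge0.
  by apply: mulr_ge0; [exact: sqr_ge0|exact: le_trans s4_ge1].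
have l0 : 0 <= lead by exact: le_trans lead_ge.
have y1 : 0 < 1 + y by rewrite addr_gt0.
have h1 : 2 * c / K * (c / (1 + c)) <=
    lead * (1 + 8 / 3 * delta * ratio) * (y / (1 + y)).
  apply: ler_pM => //; apply: le_trans lead_ge _.
  by rewrite ler_peMr// lerDl.
apply: le_trans (lerD h h1) _.
rewrite -mulrDr -[leRHS]mulr1 ler_wpM2l//.
  by apply: mulr_ge0 => //; rewrite addr_ge0.
by rewrite -[X in X + _]div1r -mulrDl divff// gt_eqF.
Qed.

End SurvivalGaps.

(** * Deduction of (i)-(iv) from closeness of [C1 / n] to [rho] *)

Section Conclusions.
Variables (R : realType) (ns : nat -> nat) (F : forall k, graph (ns k)) (t K : R).
Variable Pr : forall k, pred (graph (ns k)) -> R.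
Hypotheses (n_gt0 : forall k, (0 < ns k)%N) (t_gt0 : 0 < t).
Hypothesis s3_le : forall k, sk 3 (F k) <= K.
Hypothesis model : forall eps del : R, 0 < eps -> 0 < del ->
  exists k0 : nat, forall k, (k0 <= k)%N -> exists E : (graph (ns k) -> R) -> R,
    [/\ expectation E, forall A, Pr A = E (ind A) &
        forall rho, giant_fraction (F k) t rho -> E (ind (far rho eps)) <= del].
Local Open Scope classical_set_scope.
Local Open Scope ring_scope.

(** Each probabilistic claim is an event implied by [C1 / n] being within some fixed [eps] of [rho],
    so its probability is at least 1 minus that of [far]. *)
Lemma whp_of_close (P : forall k, pred (graph (ns k))) (rho : nat -> R) (eps : R) :
  0 < eps -> (forall k, giant_fraction (F k) t (rho k)) ->
  (exists k1 : nat, forall k, (k1 <= k)%N -> forall G : graph (ns k),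
     `|(C1 G)%:R / (ns k)%:R - rho k| <= eps -> P k G) ->
  (fun k => Pr (P k)) @ \oo --> (1 : R).
Proof.
move=> eps0 gf [k1 k1P]; apply/cvgrPdist_le => del del0.
have [k0 k0P] := model eps0 del0.
exists (maxn k0 k1) => // k /=; rewrite geq_max => /andP[kk0 kk1].
have [E [expE -> far_le]] := k0P k kk0.
have le1 : E (ind (P k)) <= 1.
  rewrite -[leRHS](expect1 expE); apply: (expect_le expE) => G.
  by rewrite /ind lern1; case: (P k G).
rewrite ger0_norm ?subr_ge0// lerBlDr.
apply: (@le_trans _ _ (E (ind (far (rho k) eps)) + E (ind (P k)))); last first.
  by rewrite lerD2r far_le.
rewrite -(expectD expE) -[leLHS](expect1 expE); apply: (expect_le expE) => G.
rewrite /ind /far -natrD ler1n; by have [/k1P ->//|//] := boolP (_ <= eps).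
Qed.

Lemma conclusions_of_model : conclusions ns F t Pr.
Proof.
have roots : (forall k, (sk 2 (F k) : R)^-1 < t) -> exists rho : nat -> R,
    forall k, 0 < rho k /\ rho k = 1 - expZ (F k) (rho k * t).
  move=> ht.
  have ex k : exists r : R, 0 < r /\ r = 1 - expZ (F k) (r * t).
    by have [r [rP _]] := giant_fraction_unique (n_gt0 k) t_gt0 (ht k); exists r.
  by have [rho rhoP] := choice ex; exists rho.
have K0 : 0 < K by apply: lt_le_trans (s3_le 0); apply: lt_le_trans (sk_ge1 R (n_gt0 0) 2 _).
rewrite /conclusions; split.
  (* Up to the threshold 0 is an admissible [giant_fraction]. *)
  move=> ht eps eps0; apply: (@whp_of_close _ (fun=> 0) eps) => //.
    by move=> k; right.
  exists 0%N => k _ G; rewrite subr0; apply: le_trans; exact: ler_norm.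
split.
  split; first by move=> k; exact: giant_fraction_unique.
  move=> _ rho rhoP eps eps0; apply: (@whp_of_close _ rho eps) => //.
    by move=> k; left.
  by exists 0%N.
split.
  move=> ht; have [rho rhoP] := roots ht.
  have gf k : giant_fraction (F k) t (rho k) by left.
  have d0 k : 0 < t - (sk 2 (F k))^-1 by rewrite subr_gt0.
  split=> [|hr] eps eps0; apply: (@whp_of_close _ rho eps) => //;
    exists 0%N => k _ G; rewrite ler_norml => /andP[h1 h2]; have [r0 rE] := rhoP k.
    have := lower_gap (n_gt0 k) t_gt0 r0 rE (d0 k) (lexx 0) (ltW (d0 k)) (s3_le k).
    by rewrite mulr0 !mul0r addr0; lra.
  have := upper_gap (n_gt0 k) t_gt0 r0 rE (d0 k) (lexx 0) (ltW (d0 k)) (s3_le k) (hr k).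
  by rewrite mulr0 !mul0r addr0; lra.
move=> ht [c [c0 [k1 _ ck]]]; have [rho rhoP] := roots ht.
have gf k : giant_fraction (F k) t (rho k) by left.
have d0 k : 0 < t - (sk 2 (F k))^-1 by rewrite subr_gt0.
have g1 : 0 < 2 * c / K by rewrite divr_gt0// mulr_gt0.
have g2 : 0 < c / (1 + c) by rewrite divr_gt0// addr_gt0.
split=> [|hr].
  (* The radius of closeness is the margin itself, so no error term survives. *)
  apply: (@whp_of_close _ rho (2 * c / K * (c / (1 + c)) ^+ 2)) => //.
    by apply: mulr_gt0 => //; exact: exprn_gt0.
  exists k1 => k kk1 G; rewrite ler_norml => /andP[h1 h2]; have [r0 rE] := rhoP k.
  have := lower_gap (n_gt0 k) t_gt0 r0 rE (d0 k) (ltW c0) (ck k kk1) (s3_le k).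
  by lra.
apply: (@whp_of_close _ rho (2 * c / K * (c / (1 + c)))) => //; first exact: mulr_gt0.
exists k1 => k kk1 G; rewrite ler_norml => /andP[h1 h2]; have [r0 rE] := rhoP k.
have := upper_gap (n_gt0 k) t_gt0 r0 rE (d0 k) (ltW c0) (ck k kk1) (s3_le k) (hr k).
by lra.
Qed.

End Conclusions.

Theorem theorem2p1 (R : realType) (ns : nat -> nat)
  (F : forall k, graph (ns k)) (t : R) :
  (0 < ns 0)%N ->
  (forall k, (ns k < ns k.+1)%N) ->
  (forall k, simple_graph (F k)) ->
  (exists K : R, forall k, (sk 3 (F k) : R) <= K) ->
  0 < t ->
  conclusions ns F t (fun k => Pr_tilde t (F k))
  /\ conclusions ns F t
       (fun k => Pr_unif (Num.truncn ((ns k)%:R * t / 2)) (F k))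
  /\ conclusions ns F t
       (fun k => Pr_star (Num.truncn ((ns k)%:R * t / 2)) (F k)).
Proof.
move=> n0 nS sF [K KP] t0.
(* Thresholds on the number of vertices thereby become thresholds on the index [k]. *)
have ns_ge k : (k < ns k)%N.
  by elim: k => // k IH; apply: leq_ltn_trans IH (nS k).
have n_gt0 k : (0 < ns k)%N by exact: leq_ltn_trans (ns_ge k).
have K2 k : sk 2 (F k) <= K by apply: le_trans (KP k); exact: sk_mono.
have K0 : 0 <= K by apply: le_trans (K2 0); apply: le_trans (sk_ge1 R (n_gt0 0) 1 _).
have nsk m k : (m <= k)%N -> (m <= ns k)%N.
  by move=> mk; apply: leq_trans mk (ltnW (ns_ge k)).
split; [|split]; apply: (conclusions_of_model n_gt0 t0 KP) => eps del eps0 del0.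
- have [m mP] := tilde_giant K0 t0 eps0 del0; exists m => k mk.
  have [h1 h2] := mP _ (F k) (n_gt0 k) (nsk m k mk) (sF k) (K2 k).
  by exists (tilde_mean t (F k)); split => // A; exact: Pr_tilde_mean.
- have [m mP] := unif_giant K0 t0 eps0 del0; exists m => k mk.
  have [h1 h2] := mP _ (F k) (n_gt0 k) (nsk m k mk) (sF k) (K2 k).
  by eexists; split; [exact: h1|by []|exact: h2].
- have [m mP] := star_giant t0 eps0 del0; exists m => k mk.
  have [h1 h2] := mP _ (F k) (n_gt0 k) (nsk m k mk).
  by eexists; split; [exact: h1|by []|exact: h2].
Qed.
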